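(* The images $\phi(S_3)$, $\phi(S_5)$, $\phi(S_6)$, $\phi(S_7)$ and $\phi(S_{11})$ are single points in $\overline{P}_{1,3}$, and $$\phi(S_5)=\phi(S_6)=\phi(S_7)=\phi(S_{11}).$$
   Context: Let $k$ be an algebraically closed field of characteristic not $2$ or $3$, $\mathbb{P}^2=\mathrm{Proj}\,k[x_0,x_1,x_2]$, $V^\vee=k[x_0,x_1,x_2]_1$. Pairs $(C,L)$ consisting of a cubic curve and a line are parametrized by $\mathbb{P}(S^3V)\times\mathbb{P}(V)$, with $\mathrm{PGL}(3)$-action $g\cdot(V(F(x)),V(S(x)))=(V(F(g^{-1}x)),V(S(g^{-1}x)))$. Semistability is in the GIT sense with respect to the $\mathrm{SL}(3)$-linearized bundle $\mathcal{O}(1,1)$, and $\phi:(\mathbb{P}(S^3V)\times\mathbb{P}(V))^{ss}\to\overline{P}_{1,3}=(\mathbb{P}(S^3V)\times\mathbb{P}(V))^{ss}/\!/\mathrm{PGL}(3)$ is the good categorical quotient. The loci $S_i$ are the following sets of semistable pairs $(C,L)$: $S_3$: $C$ is a $3$-gon (three non-concurrent lines) and $L$ is transversal to $C$; $S_5$: $C=L'+Q$ with $L'$ a line and $Q$ an irreducible conic, and $L$ is tangent to $Q$; $S_6$: $C=L'+Q$ with $L'$ a line and $Q$ an irreducible conic, and $L'$ is tangent to $Q$; $S_7$: $C=L'+Q$ with $L'$ a line and $Q$ an irreducible conic, and both $L$ and $L'$ are tangent to $Q$; $S_{11}$: $C$ is an irreducible cubic with a cusp and $L$ is $2$-tangent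 to $C$, i.e. tangent but not triply tangent at a smooth point of $C$. *)

(* Defs.v *)
From mathcomp Require Import all_boot all_order all_algebra.
From mathcomp Require Import boolp classical_sets.
From mathcomp Require Import mpoly.

Set Implicit Arguments.
Unset Strict Implicit.
Unset Printing Implicit Defensive.

Import GRing.Theory.
Local Open Scope ring_scope.
Local Open Scope classical_set_scope.

Section CubicLinePairs.
Variable k : closedFieldType.

(* Points of P^2 are represented by nonzero vectors p : 'rV[k]_3, curves by
   nonzero forms; a form and its nonzero multiples define the same curve
   (cf. git_quotient_scale below for the independence of the representatives). *)

Record pair := Pair {
  cubic : {mpoly k[3]};
  line : {mpoly k[3]};
  cubic_homog : cubic \is 3.-homog;
  cubic_neq0 : cubic != 0;
  line_homog : line \is 1.-homog;
  line_neq0 : line != 0 }.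

(* (g . F)(x) = F (g^-1 x), x a column vector *)
Definition act (g : 'M[k]_3) (F : {mpoly k[3]}) : {mpoly k[3]} :=
  F \mPo [tuple \sum_(j < 3) invmx g i j *: 'X_j | i < 3].

(* Global sections of O(n, n) on P(S^3 V) x P(V): bihomogeneous polynomials in
   the coefficients of the cubic (one variable per cubic monomial) and in the
   three coefficients of the line. *)

Definition cubic_monom := {m : 'X_{1..3 < 4} | mdeg m == 3}.

Definition section_ring := {mpoly k[#|{: cubic_monom}| + 3]}.

Definition coefs (F S : {mpoly k[3]}) (i : 'I_(#|{: cubic_monom}| + 3)) : k :=
  match split i with
  | inl j => F@_(val (val (enum_val j)))
  | inr j => S@_U_(j)%MM
  end.

Definition bihomog (n : nat) (f : section_ring) : Prop :=
  forall m, m \in msupp f ->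
    (\sum_(i < #|{: cubic_monom}|) m (lshift 3 i))%N = n /\
    (\sum_(j < 3) m (rshift #|{: cubic_monom}| j))%N = n.

(* As k is infinite, invariance of the polynomial f can be tested on values. *)
Definition SL3_invariant (f : section_ring) : Prop :=
  forall (g : 'M[k]_3) (F S : {mpoly k[3]}),
    \det g = 1 -> F \is 3.-homog -> S \is 1.-homog ->
    f.@[coefs (act g F) (act g S)] = f.@[coefs F S].

Definition invariant_section (n : nat) : set section_ring :=
  [set f | bihomog n f /\ SL3_invariant f].

Definition semistable (x : pair) : Prop :=
  exists n f, [/\ (0 < n)%N, invariant_section n f
                & f.@[coefs (cubic x) (line x)] <> 0].

Record sspair := SSPair { sspair_pair :> pair; sspairP : semistable sspair_pair }.

(* The quotient is Proj of the graded ring (+)_n H^0(O(n, n))^SL(3). Its points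
   are the homogeneous primes not containing the irrelevant ideal, given here
   by their graded pieces. *)
Record Proj_invariants := ProjInvariants {
  pt_ideal : nat -> set section_ring;
  pt_sub : forall n, pt_ideal n `<=` invariant_section n;
  pt_0 : forall n, pt_ideal n 0;
  pt_D : forall n f g, pt_ideal n f -> pt_ideal n g -> pt_ideal n (f + g);
  pt_M : forall m n f g,
    invariant_section m f -> pt_ideal n g -> pt_ideal (m + n)%N (f * g);
  pt_prime : forall m n f g,
    invariant_section m f -> invariant_section n g ->
    pt_ideal (m + n)%N (f * g) -> pt_ideal m f \/ pt_ideal n g;
  pt_relevant : exists n f,
    [/\ (0 < n)%N, invariant_section n f & ~ pt_ideal n f] }.

Lemma Proj_invariants_eq (P Q : Proj_invariants) :
  pt_ideal P = pt_ideal Q -> P = Q.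
Proof.
case: P => I a b c d e f; case: Q => J a' b' c' d' e' f' /= eqI.
by subst J; congr ProjInvariants; exact: Prop_irrelevance.
Qed.

Lemma invariant_section0 n : invariant_section n 0.
Proof. by split=> [m|g F S _ _ _]; rewrite ?msupp0 // !meval0. Qed.

Lemma invariant_sectionD n f g :
  invariant_section n f -> invariant_section n g -> invariant_section n (f + g).
Proof.
move=> [hf If] [hg Ig]; split=> [m /msuppD_le|h F S dh hF hS].
  by rewrite mem_cat => /orP[/hf|/hg].
by rewrite !mevalD If ?Ig.
Qed.

Lemma invariant_sectionM m n f g :
  invariant_section m f -> invariant_section n g ->
  invariant_section (m + n)%N (f * g).
Proof.
move=> [hf If] [hg Ig]; split=> [u /msuppM_le|h F S dh hF hS].
  case/allpairsP=> -[u1 u2] /= [/hf[a1 b1] /hg[a2 b2] ->].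
  split; first by rewrite -a1 -a2 -big_split; apply: eq_bigr => i _; rewrite mnmDE.
  by rewrite -b1 -b2 -big_split; apply: eq_bigr => i _; rewrite mnmDE.
by rewrite !mevalM If ?Ig.
Qed.

Definition vanishing_ideal (x : pair) (n : nat) : set section_ring :=
  [set f | invariant_section n f /\ f.@[coefs (cubic x) (line x)] = 0].

Lemma vanishing_sub x n : vanishing_ideal x n `<=` invariant_section n.
Proof. by move=> f []. Qed.

Lemma vanishing_0 x n : vanishing_ideal x n 0.
Proof. by split; [exact: invariant_section0 | rewrite meval0]. Qed.

Lemma vanishing_D x n f g :
  vanishing_ideal x n f -> vanishing_ideal x n g -> vanishing_ideal x n (f + g).
Proof.
by move=> [hf f0] [hg g0]; split; [exact: invariant_sectionD|rewrite mevalD f0 g0 addr0].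
Qed.

Lemma vanishing_M x m n f g :
  invariant_section m f -> vanishing_ideal x n g ->
  vanishing_ideal x (m + n)%N (f * g).
Proof.
by move=> hf [hg g0]; split; [exact: invariant_sectionM|rewrite mevalM g0 mulr0].
Qed.

Lemma vanishing_prime x m n f g :
  invariant_section m f -> invariant_section n g ->
  vanishing_ideal x (m + n)%N (f * g) ->
  vanishing_ideal x m f \/ vanishing_ideal x n g.
Proof.
move=> hf hg [_ /eqP]; rewrite mevalM mulf_eq0 => /orP[/eqP f0|/eqP g0].
  by left.
by right.
Qed.

Lemma vanishing_relevant (x : sspair) : exists n f,
  [/\ (0 < n)%N, invariant_section n f & ~ vanishing_ideal x n f].
Proof.
by case: (sspairP x) => n [f [n0 hf f0]]; exists n, f; split => // -[_ /f0].
Qed.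

Definition git_quotient (x : sspair) : Proj_invariants :=
  ProjInvariants (@vanishing_sub x) (@vanishing_0 x) (@vanishing_D x)
    (@vanishing_M x) (@vanishing_prime x) (vanishing_relevant x).

Lemma coefs_scale (a b : k) F S n f : bihomog n f ->
  f.@[coefs (a *: F) (b *: S)] = (a ^+ n * b ^+ n) * f.@[coefs F S].
Proof.
move=> hf; rewrite /meval /mmap mulr_sumr; apply: eq_big_seq => m /hf[h1 h2].
rewrite mulrCA; congr (_ * _).
rewrite /mmap1 !big_split_ord /= mulrACA; congr (_ * _).
  rewrite -[in RHS]h1 expr_sum -big_split /=; apply: eq_bigr => i _.
  by rewrite /coefs (unsplitK (inl i)) mcoeffZ exprMn.
rewrite -[in RHS]h2 expr_sum -big_split /=; apply: eq_bigr => i _.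
by rewrite /coefs (unsplitK (inr i)) mcoeffZ exprMn.
Qed.

Lemma git_quotient_scale (x y : sspair) (a b : k) : a != 0 -> b != 0 ->
  cubic y = a *: cubic x -> line y = b *: line x ->
  git_quotient x = git_quotient y.
Proof.
move=> a0 b0 eF eS; apply: Proj_invariants_eq => /=.
apply: funext => n; apply/seteqP; split=> f /= [hf e]; split => //.
  by rewrite eF eS (coefs_scale a b _ _ hf.1) e mulr0.
move/eqP: e; rewrite eF eS (coefs_scale a b _ _ hf.1) !mulf_eq0.
by rewrite !expf_eq0 (negPf a0) (negPf b0) !andbF => /eqP.
Qed.

Definition linear_form (l : {mpoly k[3]}) : Prop := l \is 1.-homog /\ l != 0.

Definition irreducible_form (F : {mpoly k[3]}) : Prop :=
  [/\ F != 0, F \isn't a GRing.unit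
    & forall A B, F = A * B -> A \is a GRing.unit \/ B \is a GRing.unit].

Definition irreducible_conic (Q : {mpoly k[3]}) : Prop :=
  Q \is 2.-homog /\ irreducible_form Q.

Definition grad (F : {mpoly k[3]}) (p : 'rV[k]_3) : 'rV[k]_3 :=
  \row_(i < 3) (F^`M(i)).@[p 0].

Definition on_curve (F : {mpoly k[3]}) (p : 'rV[k]_3) : Prop :=
  p != 0 /\ F.@[p 0] = 0.

Definition transversal_line (F S : {mpoly k[3]}) : Prop :=
  forall p, on_curve F p -> on_curve S p ->
    \rank (col_mx (grad F p) (grad S p)) = 2%N.

(* p is a smooth point of V(F), with tangent line V(S) *)
Definition tangent_at (F S : {mpoly k[3]}) (p : 'rV[k]_3) : Prop :=
  [/\ on_curve F p, on_curve S p, grad F p != 0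
    & exists c : k, grad F p = c *: grad S p].

Definition tangent (F S : {mpoly k[3]}) : Prop := exists p, tangent_at F S p.

(* The polynomial F (p + t q) in t *)
Definition along (F : {mpoly k[3]}) (p q : 'rV[k]_3) : {poly k} :=
  mmap (@polyC k) (fun i => (p 0 i)%:P + q 0 i *: 'X) F.

(* For p on V(F) and on the line V(S): the intersection multiplicity of V(F)
   and V(S) at p is at least m. *)
Definition contact (m : nat) (F S : {mpoly k[3]}) (p : 'rV[k]_3) : Prop :=
  forall q : 'rV[k]_3, S.@[q 0] = 0 -> 'X^m %| along F p q.

Definition two_tangent (F S : {mpoly k[3]}) : Prop :=
  exists p, tangent_at F S p /\ ~ contact 3 F S p.

(* An (ordinary, i.e. A_2) cusp at p: a double point whose tangent cone is a
   double line V(l), such that V(l) meets V(F) at p with multiplicity exactly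
   3. *)
Definition cusp_at (F : {mpoly k[3]}) (p : 'rV[k]_3) : Prop :=
  [/\ on_curve F p, grad F p = 0
    & exists l, [/\ linear_form l,
        forall v : 'rV[k]_3, (along F p v)`_2 = l.@[v 0] ^+ 2
      & forall v : 'rV[k]_3, l.@[v 0] = 0 -> \rank (col_mx p v) = 2%N ->
          (along F p v)`_3 <> 0]].

Definition S3 : set sspair := [set x |
  (exists l1 l2 l3, [/\ linear_form l1, linear_form l2, linear_form l3,
      (forall p : 'rV[k]_3,
         l1.@[p 0] = 0 -> l2.@[p 0] = 0 -> l3.@[p 0] = 0 -> p = 0)
    & cubic x = l1 * l2 * l3]) /\
  transversal_line (cubic x) (line x)].

Definition S5 : set sspair := [set x |
  exists l Q, [/\ linear_form l, irreducible_conic Q, cubic x = l * Q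
    & tangent Q (line x)]].

Definition S6 : set sspair := [set x |
  exists l Q, [/\ linear_form l, irreducible_conic Q, cubic x = l * Q
    & tangent Q l]].

Definition S7 : set sspair := [set x |
  exists l Q, [/\ linear_form l, irreducible_conic Q, cubic x = l * Q,
    tangent Q (line x) & tangent Q l]].

Definition S11 : set sspair := [set x |
  [/\ irreducible_form (cubic x), exists p, cusp_at (cubic x) p
    & two_tangent (cubic x) (line x)]].

End CubicLinePairs.

Arguments git_quotient {k} x.
Arguments S3 k : clear implicits.
Arguments S5 k : clear implicits.
Arguments S6 k : clear implicits.
Arguments S7 k : clear implicits.
Arguments S11 k : clear implicits.

(* Main.v *)
(* Two degenerations carry the proof.  Let the weights of x0, x1, x2 under a
   one-parameter subgroup of SL(3) be 1, 0, -1.  If every monomial of F has weight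
   at most 1 and S = x2, then an invariant of bidegree (n, n) takes the same value
   at (F, S) and at (a x0^2 x2 + b x0 x1^2, x2), the part of weight (1, -1).  These
   two conditions say exactly that V(S) is a line in the tangent space of V(F) at
   [1 : 0 : 0].  When a b = 0 the limit is unstable, and otherwise it is
   projectively equivalent to T = (x0 (x0 x2 - x1^2), x2); this settles S5, S7 and
   S11 together.  For S6 the subgroup is used in the other direction: if all the
   weights of F are at least 1 and S is any line, the limit has the same shape.
   S3 is a single orbit.  Semistability of T, of a point of S3 and of a point of
   S11 is detected by the Cayleyan, an invariant of bidegree (3, 3). *)

Require Import Defs.
From mathcomp Require Import all_boot all_order all_algebra.
From mathcomp Require Import boolp classical_sets.
From mathcomp Require Import mpoly.
From mathcomp Require Import zify ring.
From HB Require Import structures.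

Set Implicit Arguments.
Unset Strict Implicit.
Unset Printing Implicit Defensive.

Import Order.TTheory GRing.Theory Num.Theory.
Local Open Scope ring_scope.
Local Open Scope classical_set_scope.

(** * Linear substitutions and one-parameter degenerations *)

(** A point of the quotient is the family of ideals of invariants vanishing on a pair, so two images
    agree as soon as the same invariants vanish on both pairs; no closed orbit or orbit closure has
    to be described. Limits are equally algebraic: along a one-parameter subgroup an invariant is a
    polynomial in t that is constant for t nonzero, hence constant. Semistability therefore passes
    from a pair to its limit, which is how the coefficients a and b of the limit are seen to be
    nonzero. An image is a single point only if the locus has a member, and a member needs a proof
    of semistability, that is, a concrete invariant with a nonzero value. The linearization O(1, 1)
    asks for equal degrees in the cubic and the line, which the Cayleyan has. Its invariance comes
    from the symbolic form, as a contraction with four alternating tensors, and its values from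
    computation over the integers: -24, 48 and 432, with no prime factors but 2 and 3. The
    characteristic enters here, and once more through 3 when a tangent of the cuspidal cubic is
    shown not to be triply tangent. *)

Section Substitution.
Variable k : closedFieldType.
Implicit Types (F G S : {mpoly k[3]}) (h g : 'M[k]_3) (f : section_ring k).

(** [act g] is [subst (invmx g)]. Dropping the inverse makes the columns of [h] the points to which
    the coordinate points are sent, so normal forms can be reached by prescribing a frame. *)
Definition subst h F : {mpoly k[3]} :=
  F \mPo [tuple \sum_(j < 3) h i j *: 'X_j | i < 3].

Lemma subst_is_linear h : linear (subst h).
Proof. by move=> a F G; rewrite /subst comp_mpolyD comp_mpolyZ. Qed.

Lemma subst_is_monoid_morphism h : monoid_morphism (subst h).
Proof. by split=> [|F G]; rewrite /subst ?rmorph1 ?rmorphM. Qed.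

HB.instance Definition _ h := GRing.isLinear.Build k {mpoly k[3]} {mpoly k[3]} *:%R
  (subst h) (subst_is_linear h).
HB.instance Definition _ h := GRing.isMonoidMorphism.Build {mpoly k[3]} {mpoly k[3]}
  (subst h) (subst_is_monoid_morphism h).

Lemma substZ h a F : subst h (a *: F) = a *: subst h F.
Proof. exact: linearZ. Qed.

Lemma substD h F G : subst h (F + G) = subst h F + subst h G.
Proof. exact: raddfD. Qed.

Lemma substM h F G : subst h (F * G) = subst h F * subst h G.
Proof. exact: rmorphM. Qed.

Lemma subst_mnm h (m : 'X_{1..3}) :
  subst h 'X_[m] = \prod_(i < 3) (\sum_(j < 3) h i j *: 'X_j) ^+ m i.
Proof. by rewrite /subst comp_mpolyX; apply: eq_bigr => i _; rewrite tnth_mktuple. Qed.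

Lemma substX h i : subst h 'X_i = \sum_(j < 3) h i j *: 'X_j.
Proof. by rewrite /subst comp_mpolyXU -tnth_nth tnth_mktuple. Qed.

Lemma meval_subst h F v :
  (subst h F).@[v] = F.@[fun i => \sum_(j < 3) h i j * v j].
Proof.
rewrite /subst comp_mpoly_meval; apply: meval_eq => i; rewrite tnth_mktuple.
by rewrite raddf_sum /=; apply: eq_bigr => j _; rewrite mevalZ mevalXU.
Qed.

Lemma linear_homog (a : 'I_3 -> k) :
  (\sum_(j < 3) a j *: 'X_j : {mpoly k[3]}) \is 1.-homog.
Proof. by apply: rpred_sum => j _; apply: dhomogZ; rewrite dhomogX /= mdeg1. Qed.

Lemma subst_homog d h F : F \is d.-homog -> subst h F \is d.-homog.
Proof.
move=> hF; rewrite [F]mpolyE (linear_sum (subst _)) /= big_seq; apply: rpred_sum => m mF.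
rewrite substZ; apply: dhomogZ; rewrite subst_mnm.
have -> : d = (\sum_(i < 3) m i)%N by rewrite -mdegE (dhomog_mf hF mF).
elim/big_rec2: _ => [|i x y _ hy]; first exact: dhomog1.
apply: dhomogM => //; rewrite -[y in y.-homog]mul1n.
exact/dhomogMn/linear_homog.
Qed.

Lemma subst_scale d h a F :
  F \is d.-homog -> subst (a *: h) F = a ^+ d *: subst h F.
Proof.
move=> hF; rewrite [F]mpolyE !(linear_sum (subst _)) scaler_sumr /=; apply: eq_big_seq => m mF.
rewrite !substZ scalerA mulrC -scalerA; congr (_ *: _); rewrite !subst_mnm.
have -> : d = (\sum_(i < 3) m i)%N by rewrite -mdegE (dhomog_mf hF mF).
rewrite expr_sum -scaler_prod; apply: eq_bigr => i _.
by rewrite -exprZn scaler_sumr; congr (_ ^+ _); apply: eq_bigr => j _; rewrite mxE scalerA.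
Qed.

Lemma subst_diag (d : 'rV[k]_3) F m :
  (subst (diag_mx d) F)@_m = F@_m * \prod_i d 0 i ^+ m i.
Proof.
have E i : \sum_(j < 3) diag_mx d i j *: 'X_j = d 0 i *: 'X_i :> {mpoly k[3]}.
  rewrite (bigD1 i) //= mxE eqxx big1 ?addr0 // => j ji.
  by rewrite mxE eq_sym (negPf ji) scale0r.
rewrite {1}[F]mpolyE (linear_sum (subst _)) raddf_sum /=.
under eq_bigr => n _.
  rewrite substZ subst_mnm.
  under eq_bigr => i _ do rewrite E exprZn.
  rewrite scaler_prod -mpolyXE_id mcoeffZ mcoeffZ mcoeffX.
over.
case: (boolP (m \in msupp F)) => mF.
  rewrite (bigD1_seq m) //= eqxx mulr1 [X in _ + X]big1 ?addr0 // => n nm.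
  by rewrite (negPf nm) !mulr0.
rewrite (memN_msupp_eq0 mF) mul0r big_seq big1 // => n nF.
by case: eqP nF mF => [-> ->|]; rewrite // !mulr0.
Qed.

Lemma invariant_subst_SL n f h F S : invariant_section n f -> \det h = 1 ->
  F \is 3.-homog -> S \is 1.-homog ->
  f.@[coefs (subst h F) (subst h S)] = f.@[coefs F S].
Proof.
move=> [_ If] dh hF hS; have := If (invmx h) F S.
by rewrite /act invmxK -!/(subst _ _) det_inv dh invr1; apply.
Qed.

Lemma exists_root n (a : k) : exists r, r ^+ n.+1 = a.
Proof.
have /closed_rootP [r] : size ('X^(n.+1) - a%:P) != 1 by rewrite size_XnsubC.
by rewrite rootE !hornerE subr_eq0 => /eqP <-; exists r.
Qed.

(** With r a cube root of the determinant ([exists_root] is shifted by one), [r^-1 *: h] lies in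
    SL(3), and the scalar r changes the value only by a nonzero power of r. *)
Lemma invariant_subst n f h F S : invariant_section n f -> h \in unitmx ->
  F \is 3.-homog -> S \is 1.-homog ->
  f.@[coefs (subst h F) (subst h S)] = 0 <-> f.@[coefs F S] = 0.
Proof.
move=> If; rewrite unitmxE unitfE => dh hF hS.
have [r rE] := exists_root 2 (\det h).
have r0 : r != 0 by apply: contraNneq dh => r0; rewrite -rE r0 expr0n.
have hE : h = r *: (r^-1 *: h) by rewrite scalerA mulfV // scale1r.
rewrite hE (subst_scale _ r hF) (subst_scale _ r hS) (coefs_scale _ _ _ _ If.1).
rewrite (invariant_subst_SL If) //; last by rewrite detZ -rE exprVn mulVf // expf_neq0.
split=> [/eqP|->]; last by rewrite mulr0.
by rewrite !mulf_eq0 !expf_eq0 (negPf r0) !andbF => /eqP.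
Qed.

End Substitution.

Section Degeneration.
Variable k : closedFieldType.
Implicit Types (F G S : {mpoly k[3]}) (f : section_ring k).

Lemma meval_limit n (f : {mpoly k[n]}) (c : 'I_n -> {poly k}) (v : k) :
  (forall t, t != 0 -> f.@[fun i => (c i).[t]] = v) ->
  f.@[fun i => (c i).[0]] = v.
Proof.
pose p := mmap (@polyC k) c f.
have pE t : p.[t] = f.@[fun i => (c i).[t]].
  rewrite /p /meval /mmap horner_sum; apply: eq_bigr => m _.
  rewrite hornerM hornerC /mmap1 horner_prod; congr (_ * _).
  by apply: eq_bigr => i _; rewrite horner_exp.
move=> fv; rewrite -pE; apply/eqP; rewrite -subr_eq0; apply/eqP.
(* Multiplying by ['X] makes the value at 0 irrelevant: the product vanishes everywhere, whereas a
   nonzero polynomial over a closed field has a nonroot. *)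
have q0 : p - v%:P = 0.
  suff /eqP : (p - v%:P) * 'X = 0.
    by rewrite mulf_eq0 polyX_eq0 orbF => /eqP.
  apply/eqP; apply: contraT => /closed_nonrootP[t]; rewrite rootM negb_or => /andP[].
  rewrite !rootE hornerX !hornerE pE => pt t0.
  by rewrite (fv _ t0) subrr eqxx in pt.
by rewrite -[v](hornerC v 0) -hornerN -hornerD q0 horner0.
Qed.

Definition weight (w : 'I_3 -> int) (m : 'X_{1..3}) : int := \sum_i w i * (m i)%:Z.

(** The diagonal matrix with entries [t ^ w i] has determinant 1. Scaling the cubic by [t ^ (- al)]
    and the line by [t ^ al] costs nothing in bidegree (n, n) and leaves only nonnegative powers of
    t, so t = 0 can be substituted; the terms of lowest weight remain. *)
Lemma degenerate (w : 'I_3 -> int) (al : int) F F0 S S0 n f :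
    \sum_i w i = 0 -> invariant_section n f ->
    F \is 3.-homog -> S \is 1.-homog ->
    (forall m, F@_m != 0 -> (al <= weight w m)%R) ->
    (forall m, S@_m != 0 -> (- al <= weight w m)%R) ->
    (forall m, F0@_m = F@_m *+ (weight w m == al)) ->
    (forall m, S0@_m = S@_m *+ (weight w m == - al)) ->
  f.@[coefs F S] = f.@[coefs F0 S0].
Proof.
move=> w0 If hF hS wF wS F0E S0E.
(* The absolute value only supplies a natural exponent: by the weight bounds it is the true
   difference wherever the coefficient is nonzero. *)
pose c (i : 'I_(#|{: cubic_monom}| + 3)) : {poly k} := match split i with
  | inl j => let m := val (val (enum_val j)) in F@_m *: 'X^(`|weight w m - al|)
  | inr j => let m := U_(j)%MM in S@_m *: 'X^(`|weight w m + al|) end.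
have c0 : coefs F0 S0 =1 (fun i => (c i).[0]).
  move=> i; rewrite /coefs /c; case: split => j; rewrite hornerZ hornerXn expr0n.
    by rewrite F0E absz_eq0 subr_eq0 mulr_natr.
  by rewrite S0E absz_eq0 addr_eq0 mulr_natr.
rewrite (meval_eq _ c0); apply/esym; apply: meval_limit => t t0.
pose d : 'rV[k]_3 := \row_i t ^ w i.
have dm (m : 'X_{1..3}) : \prod_i d 0 i ^+ m i = t ^ weight w m.
  rewrite /weight; elim/big_rec2: _ => [|i x y _ ->]; first by rewrite expr0z.
  by rewrite mxE expfzDr // -exprz_exp exprnP.
rewrite -(invariant_subst_SL If (h := diag_mx d)) //; last first.
  rewrite det_diag -[RHS](expr0z t) -w0.
  elim/big_rec2: _ => [|i x y _ ->]; first by rewrite expr0z.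
  by rewrite mxE expfzDr.
have -> : f.@[coefs (subst (diag_mx d) F) (subst (diag_mx d) S)] =
   f.@[coefs (t ^ (- al) *: subst (diag_mx d) F) (t ^ al *: subst (diag_mx d) S)].
  by rewrite (coefs_scale _ _ _ _ If.1) -exprMn -expfzDr // addNr expr0z expr1n mul1r.
apply: meval_eq => i; rewrite /coefs /c; case: split => j.
  set m := val _; rewrite mcoeffZ subst_diag dm hornerZ hornerXn.
  have [->|Fm] := eqVneq F@_m 0; first by rewrite !mul0r mulr0.
  rewrite mulrCA -expfzDr // exprnP.
  by rewrite gez0_abs ?subr_ge0 ?wF // [- al + _]addrC.
set m := U_(j)%MM; rewrite mcoeffZ subst_diag dm hornerZ hornerXn.
have [->|Sm] := eqVneq S@_m 0; first by rewrite !mul0r mulr0.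
rewrite mulrCA -expfzDr // exprnP.
by rewrite gez0_abs [weight _ _ + _]addrC // -[al]opprK addrC subr_ge0 wS.
Qed.

End Degeneration.

(** * The Cayleyan *)

Section Alternating.

Definition o0 : 'I_3 := Ordinal (isT : 0 < 3)%N.
Definition o1 : 'I_3 := Ordinal (isT : 1 < 3)%N.
Definition o2 : 'I_3 := Ordinal (isT : 2 < 3)%N.

Lemma sum3 (V : nmodType) (F : 'I_3 -> V) : \sum_i F i = F o0 + F o1 + F o2.
Proof.
rewrite !big_ord_recr big_ord0 /= add0r.
by congr (F _ + F _ + F _); apply: val_inj.
Qed.

Lemma prod3 (R : pzSemiRingType) (F : 'I_3 -> R) : \prod_i F i = F o0 * F o1 * F o2.
Proof.
rewrite !big_ord_recr big_ord0 /= mul1r.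
by congr (F _ * F _ * F _); apply: val_inj.
Qed.

Lemma ord3P (P : 'I_3 -> Prop) : P o0 -> P o1 -> P o2 -> forall i, P i.
Proof.
move=> P0 P1 P2 [[|[|[|//]]] lt_i].
- by rewrite (_ : Ordinal _ = o0) //; apply: val_inj.
- by rewrite (_ : Ordinal _ = o1) //; apply: val_inj.
- by rewrite (_ : Ordinal _ = o2) //; apply: val_inj.
Qed.

Lemma det3 (R : comPzRingType) (A : 'M[R]_3) :
  \det A = A o0 o0 * A o1 o1 * A o2 o2 + A o0 o1 * A o1 o2 * A o2 o0
    + A o0 o2 * A o1 o0 * A o2 o1 - A o0 o0 * A o1 o2 * A o2 o1
    - A o0 o1 * A o1 o0 * A o2 o2 - A o0 o2 * A o1 o1 * A o2 o0.
Proof.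
have E (i : 'I_3) (j : 'I_2) : lift i j = inord (bump i j) :> 'I_3.
  by apply: val_inj; rewrite /= inordK //; case: i j => [[|[|[|//]]] ?] [[|[|//]] ?].
have E0 : inord 0 = o0 :> 'I_3 by apply: val_inj; rewrite /= inordK.
have E1 : inord 1 = o1 :> 'I_3 by apply: val_inj; rewrite /= inordK.
have E2 : inord 2 = o2 :> 'I_3 by apply: val_inj; rewrite /= inordK.
rewrite (expand_det_row _ o0) sum3 /cofactor.
do 3 rewrite (expand_det_row _ ord0) !big_ord_recr big_ord0 /= /cofactor !det_mx11 !mxE.
rewrite !E /= !E0 !E1 !E2 /bump /= ?addn0 ?add0n /=.
by ring.
Qed.

Variable R : comPzRingType.
Implicit Types (u v : 'I_3 -> R) (e : 'I_3 -> 'I_3 -> R).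

(** Contraction with the alternating tensor, in six explicit terms so that [ring] and [vm_compute]
    can work on it. *)
Definition alt3 (A : zmodType) (G : 'I_3 -> 'I_3 -> 'I_3 -> A) : A :=
  G o0 o1 o2 + G o1 o2 o0 + G o2 o0 o1 - G o0 o2 o1 - G o1 o0 o2 - G o2 o1 o0.

Definition linear_fun (f : ('I_3 -> R) -> R) : Prop :=
  forall a u v, f (fun i => a * u i + v i) = a * f u + f v.

Definition std_basis (i j : 'I_3) : R := (i == j)%:R.

Lemma linear_fun_basis f u : linear_fun f ->
  f u = u o0 * f (std_basis o0) + u o1 * f (std_basis o1) + u o2 * f (std_basis o2).
Proof.
move=> lf; have f0 : f (fun=> 0) = 0.
  apply: (addrI (f (fun=> 0))); rewrite addr0 -{1}[f _]mul1r -lf.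
  by congr f; apply: funext => i; rewrite mulr0 addr0.
rewrite -[RHS]addr0 -f0 -addrA -addrA -!lf; congr f; apply: funext.
by apply: ord3P; rewrite /std_basis /=; ring.
Qed.

Lemma linear_funMl c f : linear_fun f -> linear_fun (fun u => c * f u).
Proof. by move=> lf a u v; rewrite lf; ring. Qed.

Lemma linear_funMr c f : linear_fun f -> linear_fun (fun u => f u * c).
Proof. by move=> lf a u v; rewrite lf; ring. Qed.

Lemma linear_fun_alt3 (G : ('I_3 -> R) -> 'I_3 -> 'I_3 -> 'I_3 -> R) :
  (forall i j l, linear_fun (fun u => G u i j l)) -> linear_fun (fun u => alt3 (G u)).
Proof. by move=> lG a u v; rewrite /alt3 !lG; ring. Qed.

(** The left side is an alternating trilinear function of the three vectors of [e], hence a multiple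
    of the determinant, and the standard basis determines the multiple. *)
Lemma alt3_basis (G : ('I_3 -> R) -> ('I_3 -> R) -> ('I_3 -> R) -> R) e :
  (forall v w, linear_fun (fun u => G u v w)) ->
  (forall u w, linear_fun (fun v => G u v w)) ->
  (forall u v, linear_fun (fun w => G u v w)) ->
  alt3 (fun i j l => G (e i) (e j) (e l)) =
  \det (\matrix_(i, j) e i j) * alt3 (fun i j l => G (std_basis i) (std_basis j) (std_basis l)).
Proof.
move=> l1 l2 l3; rewrite det3 !mxE /alt3.
have E u v w : G u v w = \sum_i u i * (\sum_j v j *
      (\sum_l w l * G (std_basis i) (std_basis j) (std_basis l))).
  rewrite sum3 [LHS](linear_fun_basis _ (l1 v w)).
  congr (_ * _ + _ * _ + _ * _);
  (rewrite sum3 [LHS](linear_fun_basis _ (l2 _ w)); congr (_ * _ + _ * _ + _ * _));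
  by rewrite sum3 [LHS](linear_fun_basis _ (l3 _ _)).
(* Six rewrites expand the six terms at [e] and leave those at the standard basis alone. *)
rewrite 6!{1}E !sum3; ring.
Qed.

End Alternating.

Lemma eq_alt3 (A : zmodType) (G G' : 'I_3 -> 'I_3 -> 'I_3 -> A) :
  (forall i j l, G i j l = G' i j l) -> alt3 G = alt3 G'.
Proof. by move=> E; rewrite /alt3 !E. Qed.

Lemma raddf_alt3 (A B : zmodType) (phi : {additive A -> B}) G :
  phi (alt3 G) = alt3 (fun i j l => phi (G i j l)).
Proof. by rewrite /alt3 !raddfB !raddfD. Qed.

(* The symbolic expression (abc)(abs)(bcs)(acs) of the Cayleyan, up to sign:
   each letter is a copy of the cubic T, each bracket an [alt3]. *)
Definition cayley (A : comPzRingType) (T : 'I_3 -> 'I_3 -> 'I_3 -> A) (s : 'I_3 -> A) : A :=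
  alt3 (fun a0 b0 c0 => alt3 (fun a1 b1 l1 => alt3 (fun b2 c1 l2 => alt3 (fun c2 a2 l3 =>
    T a0 a1 a2 * T b0 b1 b2 * T c0 c1 c2 * (s l1 * s l2 * s l3))))).

Lemma eq_cayley (A : comPzRingType) (T T' : 'I_3 -> 'I_3 -> 'I_3 -> A) s s' :
  (forall i j l, T i j l = T' i j l) -> (forall i, s i = s' i) ->
  cayley T s = cayley T' s'.
Proof. by move=> ET Es; do 4!apply: eq_alt3 => ? ? ?; rewrite !ET !Es. Qed.

Lemma rmorph_cayley (A B : comPzRingType) (phi : {rmorphism A -> B}) T s :
  phi (cayley T s) = cayley (fun i j l => phi (T i j l)) (fun i => phi (s i)).
Proof.
by do 4!(rewrite raddf_alt3; apply: eq_alt3 => ? ? ? /=); rewrite !rmorphM.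
Qed.

(** The four brackets are moved from [e] to the standard basis one at a time, innermost first, each
    at the price of a determinant equal to 1. *)
Lemma cayley_basis (R : comPzRingType)
    (T : ('I_3 -> R) -> ('I_3 -> R) -> ('I_3 -> R) -> R) (s : ('I_3 -> R) -> R)
    (e : 'I_3 -> 'I_3 -> R) :
  (forall v w, linear_fun (fun u => T u v w)) ->
  (forall u w, linear_fun (fun v => T u v w)) ->
  (forall u v, linear_fun (fun w => T u v w)) ->
  linear_fun s -> \det (\matrix_(i, j) e i j) = 1 ->
  cayley (fun i j l => T (e i) (e j) (e l)) (fun i => s (e i)) =
  cayley (fun i j l => T (std_basis R i) (std_basis R j) (std_basis R l)) (fun i => s (std_basis R i)).
Proof.
move=> l1 l2 l3 ls de; rewrite /cayley.
have aux G := @alt3_basis R G e; rewrite de in aux.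
(* Each of the twelve tensor slots receives its own vector, so that the expression is linear in
   every slot and one bracket can be changed while the others stay fixed. *)
pose M a0 b0 c0 a1 b1 l1 b2 c1 l2 c2 a2 l3 :=
  T a0 a1 a2 * T b0 b1 b2 * T c0 c1 c2 * (s l1 * s l2 * s l3).
pose b := std_basis R.
Ltac multilinear l1 l2 l3 ls := by move=> ? ?; rewrite /=;
  repeat first [exact: l1 | exact: l2 | exact: l3 | exact: ls
    | apply: linear_funMr | apply: linear_funMl | apply: linear_fun_alt3 => ? ? ?].
transitivity (alt3 (fun a0 b0 c0 => alt3 (fun a1 b1 l1 => alt3 (fun b2 c1 l2 =>
    alt3 (fun c2 a2 l3 => M (e a0) (e b0) (e c0) (e a1) (e b1) (e l1)
      (e b2) (e c1) (e l2) (b c2) (b a2) (b l3)))))).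
  do 3!apply: eq_alt3 => ? ? ?.
  by rewrite -[RHS]mul1r -(aux (M _ _ _ _ _ _ _ _ _)); [| multilinear l1 l2 l3 ls ..].
transitivity (alt3 (fun a0 b0 c0 => alt3 (fun a1 b1 l1 => alt3 (fun b2 c1 l2 =>
    alt3 (fun c2 a2 l3 => M (e a0) (e b0) (e c0) (e a1) (e b1) (e l1)
      (b b2) (b c1) (b l2) (b c2) (b a2) (b l3)))))).
  do 2!apply: eq_alt3 => ? ? ?.
  rewrite -[RHS]mul1r -(aux (fun b2 c1 l2 => alt3 (fun c2 a2 l3 =>
    M _ _ _ _ _ _ b2 c1 l2 (b c2) (b a2) (b l3)))) //; multilinear l1 l2 l3 ls.
transitivity (alt3 (fun a0 b0 c0 => alt3 (fun a1 b1 l1 => alt3 (fun b2 c1 l2 =>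
    alt3 (fun c2 a2 l3 => M (e a0) (e b0) (e c0) (b a1) (b b1) (b l1)
      (b b2) (b c1) (b l2) (b c2) (b a2) (b l3)))))).
  apply: eq_alt3 => ? ? ?.
  rewrite -[RHS]mul1r -(aux (fun a1 b1 l1 => alt3 (fun b2 c1 l2 => alt3 (fun c2 a2 l3 =>
    M _ _ _ a1 b1 l1 (b b2) (b c1) (b l2) (b c2) (b a2) (b l3))))) //;
  multilinear l1 l2 l3 ls.
rewrite -[RHS]mul1r -(aux (fun a0 b0 c0 => alt3 (fun a1 b1 l1 => alt3 (fun b2 c1 l2 =>
    alt3 (fun c2 a2 l3 => M a0 b0 c0 (b a1) (b b1) (b l1) (b b2) (b c1) (b l2)
      (b c2) (b a2) (b l3)))))) //; multilinear l1 l2 l3 ls.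
Qed.

(** Full polarization by inclusion and exclusion: for a cubic form it is the symmetric trilinear
    form equal to 6 F on the diagonal, obtained without dividing. Acting on bare functions, it
    serves over the integers as well. *)
Definition polar (R : pzRingType) (F : ('I_3 -> R) -> R) (u v w : 'I_3 -> R) : R :=
  F (fun i => u i + v i + w i) - F (fun i => u i + v i) - F (fun i => u i + w i)
  - F (fun i => v i + w i) + F u + F v + F w.

Section Cayleyan.
Variable k : closedFieldType.
Implicit Types (F S : {mpoly k[3]}) (u v w : 'I_3 -> k).

Definition evalf F u : k := F.@[u].

Lemma polarC F u v w : polar (evalf F) u v w = polar (evalf F) v u w.
Proof.
rewrite /polar /evalf (@meval_eq _ _ _ (fun i => v i + u i + w i)); last first.
  by move=> i; rewrite [u i + _]addrC.
rewrite (@meval_eq _ _ (fun i => u i + v i) (fun i => v i + u i)); last first.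
  by move=> i; rewrite addrC.
by ring.
Qed.

Lemma polarCr F u v w : polar (evalf F) u v w = polar (evalf F) u w v.
Proof.
rewrite /polar /evalf (@meval_eq _ _ _ (fun i => u i + w i + v i)); last first.
  by move=> i; rewrite addrAC.
rewrite (@meval_eq _ _ (fun i => v i + w i) (fun i => w i + v i)); last first.
  by move=> i; rewrite addrC.
by ring.
Qed.

Lemma polarE F u v w :
  polar (evalf F) u v w = \sum_(m <- msupp F) F@_m * polar (evalf 'X_[m]) u v w.
Proof.
have E x : evalf F x = \sum_(m <- msupp F) F@_m * evalf 'X_[m] x.
  by rewrite /evalf {1}[F]mpolyE raddf_sum; apply: eq_bigr => m _; rewrite /= mevalZ.
rewrite /polar !E -!sumrB -!big_split /=; apply: eq_bigr => m _; ring.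
Qed.

Lemma mdeg_succ n (m : 'X_{1..3}) : mdeg m = n.+1 ->
  exists i m', m = (m' + U_(i))%MM /\ mdeg m' = n.
Proof.
move=> mn; have [i mi] : exists i, m i != 0%N.
  apply/existsP; apply: contra_eqT mn; rewrite negb_exists => /forallP m0.
  by rewrite mdegE big1 // => i _; apply/eqP; rewrite -[_ == _]negbK m0.
have E : m = (m - U_(i) + U_(i))%MM.
  apply/mnmP => j; rewrite mnmDE mnmBE mnm1E subnK //.
  by case: eqP => [<-|]; rewrite // lt0n.
exists i, (m - U_(i))%MM; split=> //; apply: succn_inj.
by rewrite -mn [in RHS]E mdegD mdeg1 addn1.
Qed.

Lemma mdeg3P (m : 'X_{1..3}) : mdeg m = 3%N ->
  exists i j l, m = (U_(i) + U_(j) + U_(l))%MM.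
Proof.
move=> /mdeg_succ[l [m1 [-> /mdeg_succ[j [m2 [-> /mdeg_succ[i [m3 [-> /eqP]]]]]]]]].
by rewrite mdeg_eq0 => /eqP->; exists i, j, l; rewrite add0m.
Qed.

(** On a product of three variables the polarization is a sum of products with one factor from each
    of u, v and w. *)
Lemma polar_linear F v w : F \is 3.-homog -> linear_fun (fun u => polar (evalf F) u v w).
Proof.
move=> hF a u u'; rewrite !polarE mulr_sumr -big_split /=; apply: eq_big_seq => m mF.
have [i [j [l ->]]] := mdeg3P (dhomog_mf hF mF).
by rewrite /polar /evalf !mpolyXD !mevalM !mevalXU; ring.
Qed.

Lemma evalf_linear S : S \is 1.-homog -> linear_fun (evalf S).
Proof.
move=> hS a u v.
have E x : evalf S x = \sum_(m <- msupp S) S@_m * evalf 'X_[m] x.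
  by rewrite /evalf {1}[S]mpolyE raddf_sum; apply: eq_bigr => m _; rewrite /= mevalZ.
rewrite !E mulr_sumr -big_split /=; apply: eq_big_seq => m mS.
have [i [m' [-> /eqP]]] := mdeg_succ (dhomog_mf hS mS).
by rewrite mdeg_eq0 => /eqP->; rewrite add0m /evalf !mevalXU; ring.
Qed.

Definition cayley_form F S : k :=
  cayley (fun i j l => polar (evalf F) (std_basis k i) (std_basis k j) (std_basis k l))
    (fun i => evalf S (std_basis k i)).

(** Substituting [h] amounts to evaluating the polarizations of F, and S itself, at the columns of
    [h] instead of the standard basis. *)
Lemma cayley_form_subst h F S : \det h = 1 -> F \is 3.-homog -> S \is 1.-homog ->
  cayley_form (subst h F) (subst h S) = cayley_form F S.
Proof.
move=> dh hF hS; rewrite /cayley_form.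
pose e i j := h j i.
have sE G u : evalf (subst h G) u = evalf G (fun i => \sum_(j < 3) h i j * u j).
  exact: meval_subst.
have eb i : (fun a => \sum_(j < 3) h a j * std_basis k i j) = e i.
  apply: funext => a; rewrite (bigD1 i) //= /std_basis eqxx mulr1 big1 ?addr0 //.
  by move=> j ji; rewrite eq_sym (negPf ji) mulr0.
rewrite -(@cayley_basis _ (polar (evalf F)) (evalf S) e) //.
- apply: eq_cayley => [i j l|i]; last by rewrite sE eb.
  rewrite /polar !sE -!eb.
  by do !congr (_ + _); try congr (- _); apply: meval_eq => a; rewrite !sum3; ring.
- by move=> v w; apply: polar_linear.
- by move=> u w a v v'; rewrite polarC polar_linear // ![polar _ _ u w]polarC.
- move=> u v a w w'; rewrite polarCr polarC polar_linear //.
  by rewrite ![polar _ _ u v]polarC ![polar _ u _ v]polarCr.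
- exact: evalf_linear.
- by rewrite -dh -det_tr; congr (\det _); apply/matrixP => i j; rewrite !mxE.
Qed.

(** The Cayleyan of the universal pair: coefficients become variables, so each polarization at basis
    vectors is a linear form in the cubic variables. *)
Definition cayleyan : section_ring k :=
  cayley (fun i j l => \sum_(x : 'I_#|{: cubic_monom}|)
      polar (evalf 'X_[val (val (enum_val x))]) (std_basis k i) (std_basis k j) (std_basis k l)
        *: 'X_(lshift 3 x))
    (fun i => 'X_(rshift #|{: cubic_monom}| i)).

Lemma cubicE F : F \is 3.-homog ->
  F = \sum_(x : 'I_#|{: cubic_monom}|)
    F@_(val (val (enum_val x))) *: 'X_[val (val (enum_val x))].
Proof.
move=> hF; apply/mpolyP => m; rewrite raddf_sum /=.
under eq_bigr => x _ do rewrite mcoeffZ mcoeffX.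
have [m3|m3] := eqVneq (mdeg m) 3%N; last first.
  rewrite (dhomog_nemf_coeff hF m3) big1 // => x _.
  case: eqP => [xm|]; last by rewrite mulr0.
  by rewrite -xm (eqP (valP (enum_val x))) in m3.
have m4 : (mdeg m < 4)%N by rewrite m3.
have bm3 : mdeg (val (BMultinom m4)) == 3%N by rewrite /= m3.
pose x0 : 'I_#|{: cubic_monom}| := enum_rank (Sub (BMultinom m4) bm3 : cubic_monom).
rewrite (bigD1 x0) //= enum_rankK /= eqxx mulr1 big1 ?addr0 // => x xx0.
case: eqP => [xm|]; last by rewrite mulr0.
case/eqP: xx0; apply: enum_val_inj; rewrite enum_rankK.
by apply: val_inj; apply: val_inj.
Qed.

Lemma evalf_basis d F i : F \is d.-homog -> evalf F (std_basis k i) = F@_(U_(i) *+ d)%MM.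
Proof.
move=> hF; rewrite /evalf mevalE [in RHS](mpolyE F) raddf_sum /=.
apply: eq_big_seq => m /(dhomog_mf hF) /= md; rewrite mcoeffZ mcoeffX; congr (_ * _).
have [->|] := eqVneq m (U_(i) *+ d)%MM.
  rewrite big1 // => j _; rewrite /std_basis mulmnE mnm1E; case: eqP => _.
    by rewrite expr1n.
  by rewrite mul0n expr0.
have [/forallP m0|] := boolP [forall j, (j != i) ==> (m j == 0%N)].
  move=> /negP[]; apply/eqP; have mi : m i = d.
    rewrite -md mdegE (bigD1 i) //= big1 ?addn0 // => j ji.
    by apply/eqP; have := m0 j; rewrite ji.
  apply/mnmP => j; rewrite mulmnE mnm1E.
  have [<-|ij] := eqVneq i j; first by rewrite mul1n.
  by apply/eqP; have := m0 j; rewrite eq_sym ij.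
rewrite negb_forall => /existsP[j]; rewrite negb_imply => /andP[ji mj] _.
by rewrite (bigD1 j) //= /std_basis eq_sym (negPf ji) expr0n (negPf mj) mul0r.
Qed.

Lemma cayleyan_meval F S : F \is 3.-homog -> S \is 1.-homog ->
  cayleyan.@[coefs F S] = cayley_form F S.
Proof.
move=> hF hS; rewrite (rmorph_cayley (meval (coefs F S))).
apply: eq_cayley => [i j l|i] /=; last first.
  by rewrite mevalXU /coefs (unsplitK (inr i)) (evalf_basis _ hS) mulm1n.
rewrite raddf_sum /=.
under eq_bigr => x _ do rewrite mevalZ mevalXU /coefs (unsplitK (inl x)) mulrC.
have E u : evalf F u = \sum_(x : 'I_#|{: cubic_monom}|)
    F@_(val (val (enum_val x))) * evalf 'X_[val (val (enum_val x))] u.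
  by rewrite /evalf {1}(cubicE hF) raddf_sum; apply: eq_bigr => m _; rewrite /= mevalZ.
rewrite /polar !E -!sumrB -!big_split /=; apply: eq_bigr => m _; ring.
Qed.

(** The factors of the Cayleyan have bidegree (1, 0) and (0, 1), which [bihomog] cannot express. *)
Definition bidegree (a b : nat) (f : section_ring k) : Prop :=
  forall m, m \in msupp f ->
    (\sum_(i < #|{: cubic_monom}|) m (lshift 3 i))%N = a /\
    (\sum_(j < 3) m (rshift #|{: cubic_monom}| j))%N = b.

Lemma bidegreeD a b f g : bidegree a b f -> bidegree a b g -> bidegree a b (f + g).
Proof. by move=> hf hg m /msuppD_le; rewrite mem_cat => /orP[/hf|/hg]. Qed.

Lemma bidegreeB a b f g : bidegree a b f -> bidegree a b g -> bidegree a b (f - g).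
Proof. by move=> hf hg; apply: bidegreeD => // m; rewrite (perm_mem (msuppN _)) => /hg. Qed.

Lemma bidegreeM a b c d f g :
  bidegree a b f -> bidegree c d g -> bidegree (a + c) (b + d) (f * g).
Proof.
move=> hf hg m /msuppM_le /allpairsP[[u1 u2] /= [/hf[a1 b1] /hg[a2 b2] ->]].
split; first by rewrite -a1 -a2 -big_split; apply: eq_bigr => i _; rewrite mnmDE.
by rewrite -b1 -b2 -big_split; apply: eq_bigr => i _; rewrite mnmDE.
Qed.

Lemma bidegree_alt3 a b G : (forall i j l, bidegree a b (G i j l)) -> bidegree a b (alt3 G).
Proof. by move=> hG; do !apply: bidegreeB => //; do !apply: bidegreeD. Qed.

Lemma cayleyan_invariant : invariant_section 3 cayleyan.
Proof.
split=> [|g F S dg hF hS]; last first.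
  rewrite /act -!/(subst _ _) !cayleyan_meval ?subst_homog // cayley_form_subst //.
  by rewrite det_inv dg invr1.
(* Each 3 is spelled as the sum that [bidegreeM] yields for three cubic factors and three line
   factors. *)
rewrite -[bihomog 3 _]/(bidegree (1 + 1 + 1 + (0 + 0 + 0)) (0 + 0 + 0 + (1 + 1 + 1)) _).
have hT i j l : bidegree 1 0 (\sum_(x : 'I_#|{: cubic_monom}|)
      polar (evalf 'X_[val (val (enum_val x))]) (std_basis k i) (std_basis k j) (std_basis k l)
        *: 'X_(lshift 3 x)).
  elim/big_rec: _ => [m|x f _ hf]; first by rewrite msupp0.
  apply: bidegreeD => // m /msuppZ_le; rewrite msuppX inE => /eqP ->.
  split.
    rewrite (bigD1 x) //= mnm1E eqxx big1 ?addn0 // => y yx.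
    by rewrite mnm1E (inj_eq (@lshift_inj _ _)) eq_sym (negPf yx).
  by rewrite big1 // => y _; rewrite mnm1E eq_lrshift.
have hs i : bidegree 0 1 ('X_(rshift #|{: cubic_monom}| i)).
  move=> m; rewrite msuppX inE => /eqP ->; split.
    by rewrite big1 // => y _; rewrite mnm1E eq_rlshift.
  rewrite (bigD1 i) //= mnm1E eqxx big1 ?addn0 // => y yx.
  by rewrite mnm1E (inj_eq (@rshift_inj _ _)) eq_sym (negPf yx).
by do 4!apply: bidegree_alt3 => ? ? ?; do !apply: bidegreeM.
Qed.

End Cayleyan.

Definition cayley_int (F S : ('I_3 -> int) -> int) : int :=
  cayley (fun i j l => polar F (std_basis int i) (std_basis int j) (std_basis int l))
    (fun i => S (std_basis int i)).

(** Forms with integral values on integral vectors have an integer as Cayleyan, which can be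
    computed once for all fields. *)
Lemma cayley_form_intr (k : closedFieldType) (F S : {mpoly k[3]}) FZ SZ :
  (forall x, evalf F (fun i => (x i)%:~R) = (FZ x)%:~R) ->
  (forall x, evalf S (fun i => (x i)%:~R) = (SZ x)%:~R) ->
  cayley_form F S = (cayley_int FZ SZ)%:~R.
Proof.
move=> FE SE; rewrite /cayley_int (rmorph_cayley (intr : int -> k)).
have bE i : std_basis k i = fun j => (std_basis int i j)%:~R.
  by apply: funext => j; rewrite /std_basis; case: eqP.
apply: eq_cayley => [i j l|i]; last by rewrite bE SE.
rewrite !bE /polar !(rmorphD, rmorphN) /= -!FE.
by do !congr (_ + _); try congr (- _); apply: meval_eq => x; rewrite !rmorphD.
Qed.

Lemma cayley_int_triangle :
  cayley_int (fun x => x o0 * x o1 * x o2) (fun x => x o0 + x o1 + x o2) = -24%:Z.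
Proof. by vm_compute. Qed.
Lemma cayley_int_tacnode :
  cayley_int (fun x => x o0 * (x o0 * x o2 - x o1 * x o1)) (fun x => x o2) = 48%:Z.
Proof. by vm_compute. Qed.

Lemma cayley_int_cusp :
  cayley_int (fun x => x o1 * x o1 * x o2 - x o0 * x o0 * x o0)
    (fun x => - 3%:Z * x o0 + 2%:Z * x o1 + x o2) = 432%:Z.
Proof. by vm_compute. Qed.

(** * Coordinate changes and normal forms *)

Section Coordinates.
Variable k : closedFieldType.
Implicit Types (F G S : {mpoly k[3]}) (h : 'M[k]_3) (u v w : 'I_3 -> k).

Definition mon (a b c : nat) : 'X_{1..3} :=
  (U_(o0) *+ a + U_(o1) *+ b + U_(o2) *+ c)%MM.

Lemma mon0 a b c : mon a b c o0 = a.
Proof. by rewrite !mnmDE !mulmnE !mnm1E mul1n !mul0n !addn0. Qed.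

Lemma mon1 a b c : mon a b c o1 = b.
Proof. by rewrite !mnmDE !mulmnE !mnm1E mul1n !mul0n add0n addn0. Qed.

Lemma mon2 a b c : mon a b c o2 = c.
Proof. by rewrite !mnmDE !mulmnE !mnm1E mul1n !mul0n !add0n. Qed.

Lemma monE (m : 'X_{1..3}) : m = mon (m o0) (m o1) (m o2).
Proof. by apply/mnmP; apply: ord3P; rewrite ?mon0 ?mon1 ?mon2. Qed.

Lemma mon_eq a b c a' b' c' :
  (mon a b c == mon a' b' c') = [&& a == a', b == b' & c == c'].
Proof.
apply/eqP/and3P => [E|[/eqP-> /eqP-> /eqP->]] //.
by have := (mon0 a b c, mon1 a b c, mon2 a b c); rewrite E mon0 mon1 mon2 => -[[-> ->] ->].
Qed.

Lemma mdeg_mon a b c : mdeg (mon a b c) = (a + b + c)%N.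
Proof. by rewrite !mdegD !mdegMn !mdeg1 !mul1n. Qed.

Lemma weight_mon x a b c : weight x (mon a b c) = x o0 * a%:Z + x o1 * b%:Z + x o2 * c%:Z.
Proof. by rewrite /weight sum3 mon0 mon1 mon2. Qed.

Lemma mon_mul a b c :
  'X_[mon a b c] = 'X_o0 ^+ a * 'X_o1 ^+ b * 'X_o2 ^+ c :> {mpoly k[3]}.
Proof. by rewrite mpolyXE_id prod3 mon0 mon1 mon2. Qed.

Lemma mon_ind d (P : 'X_{1..3} -> Prop) :
  (forall a b c, (a + b + c)%N = d -> P (mon a b c)) -> forall m, mdeg m = d -> P m.
Proof. by move=> H m md; rewrite (monE m); apply: H; rewrite -mdeg_mon -monE. Qed.

Lemma linear_formE S : S \is 1.-homog -> S = \sum_i evalf S (std_basis k i) *: 'X_i.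
Proof.
move=> hS; rewrite [LHS](mpolyE S) -[LHS](mpolyE S); apply/mpolyP => m.
rewrite raddf_sum /=; under eq_bigr => i _ do
  rewrite mcoeffZ (evalf_basis _ hS) mulm1n mcoeffX.
have [/mdeg_succ[i [m' [-> /eqP]]]|m1] := eqVneq (mdeg m) 1%N.
  rewrite mdeg_eq0 => /eqP->; rewrite add0m (bigD1 i) //= eqxx mulr1 big1 ?addr0 // => j ji.
  by rewrite eq_mnm1 (negPf ji) mulr0.
rewrite (dhomog_nemf_coeff hS m1) big1 // => i _.
have [im|] := eqVneq U_(i)%MM m; last by rewrite mulr0.
by rewrite -im mdeg1 in m1.
Qed.

Lemma evalf_subst h G u : evalf (subst h G) u = evalf G (fun i => \sum_(j < 3) h i j * u j).
Proof. exact: meval_subst. Qed.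

Lemma subst_basis h G i : evalf (subst h G) (std_basis k i) = evalf G (fun j => h j i).
Proof.
rewrite evalf_subst; apply: meval_eq => j.
rewrite (bigD1 i) //= /std_basis eqxx mulr1 big1 ?addr0 // => l li.
by rewrite eq_sym (negPf li) mulr0.
Qed.

Lemma subst_linear_form h S : S \is 1.-homog ->
  subst h S = \sum_i evalf S (fun j => h j i) *: 'X_i.
Proof.
move=> hS; rewrite [LHS]linear_formE ?subst_homog //.
by apply: eq_bigr => i _; rewrite subst_basis.
Qed.

Lemma mderivXU i l : 'X_l^`M(i) = (l == i)%:R :> {mpoly k[3]}.
Proof.
rewrite mderivX mnm1E; have [->|_] := eqVneq l i; last by rewrite scale0r.
by rewrite scale1r -{1}[U_(i)%MM]add0m addmK mpolyX0.
Qed.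

(** The chain rule, by induction on the degree of a monomial and then by linearity. *)
Lemma mderiv_subst h G j : (subst h G)^`M(j) = \sum_i h i j *: subst h G^`M(i).
Proof.
have hX l : (subst h 'X_l)^`M(j) = (h l j)%:MP.
  rewrite substX raddf_sum /= (bigD1 j) //= big1 ?addr0 => [|i ij].
    by rewrite mderivZ mderivXU eqxx -mul_mpolyC mulr1.
  by rewrite mderivZ mderivXU (negPf ij) scaler0.
have hm n : forall m : 'X_{1..3}, mdeg m = n ->
    (subst h 'X_[m])^`M(j) = \sum_i h i j *: subst h 'X_[m]^`M(i).
  elim: n => [m /eqP|n IHn m].
    rewrite mdeg_eq0 => /eqP ->; rewrite mpolyX0 rmorph1 -[1]/(1%:MP) mderivC.
    by rewrite big1 // => i _; rewrite mderivC raddf0 scaler0.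
  move=> /mdeg_succ[l [m' [-> m'n]]]; rewrite mpolyXD substM mderivM /= IHn // hX.
  under [RHS]eq_bigr => i _ do rewrite mderivM substD !substM scalerDr scalerAl.
  rewrite big_split mulr_suml /=; congr (_ + _).
  rewrite (bigD1 l) //= mderivXU eqxx rmorph1 mulr1.
  rewrite big1 ?addr0 => [|i il]; first by rewrite mulrC mul_mpolyC.
  by rewrite mderivXU eq_sym (negPf il) rmorph0 mulr0 scaler0.
rewrite [G]mpolyE (linear_sum (subst h)) raddf_sum /=.
under [RHS]eq_bigr => i _ do rewrite (raddf_sum (mderiv i)) (linear_sum (subst h)) scaler_sumr /=.
rewrite exchange_big /=; apply: eq_bigr => m _.
rewrite substZ mderivZ (hm _ m erefl) scaler_sumr; apply: eq_bigr => i _.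
by rewrite mderivZ substZ !scalerA mulrC.
Qed.

Lemma dhomog_mderiv d G i : G \is d.+1.-homog -> G^`M(i) \is d.-homog.
Proof.
move=> hG; apply/dhomogP => m; rewrite mcoeff_msupp mcoeff_mderiv => mG.
apply: succn_inj; rewrite -(@dhomog_mf _ _ _ d.+1 G hG (m + U_(i))%MM).
  by rewrite /= mdegD mdeg1 addn1.
by rewrite mcoeff_msupp; apply: contraNneq mG => ->; rewrite mul0rn.
Qed.

(* The gradient at the image of a basis vector reads off a coefficient of the
   transformed form. *)
Lemma subst_coef_grad d h G i j : G \is d.+1.-homog -> i != j ->
  (subst h G)@_(U_(i) *+ d + U_(j)) = \sum_l h l j * evalf G^`M(l) (fun a => h a i).
Proof.
move=> hG ij; transitivity (evalf (subst h G)^`M(j) (std_basis k i)).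
  rewrite (evalf_basis _ (dhomog_mderiv _ (subst_homog _ hG))) mcoeff_mderiv.
  by rewrite mulmnE mnm1E (negPf ij) mul0n mulr1n.
rewrite mderiv_subst /evalf raddf_sum /=; apply: eq_bigr => l _.
by rewrite mevalZ -[_.@[_]]/(evalf _ _) subst_basis.
Qed.

End Coordinates.

(** * Pairs that invariants do not distinguish *)

Section Equivalence.
Variable k : closedFieldType.
Implicit Types (F G S : {mpoly k[3]}) (h : 'M[k]_3) (p u v w : 'rV[k]_3).

(** Vanishing is compared rather than values, since GL(3) and rescaling multiply values by nonzero
    constants. *)
Definition same_zeros F S F' S' : Prop :=
  forall n (f : section_ring k), invariant_section n f ->
    (f.@[coefs F S] = 0 <-> f.@[coefs F' S'] = 0).

(** Stated for bare forms because a limit is not known in advance to be nonzero and hence a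
    [pair]. *)
Definition semistable_forms F S : Prop :=
  exists n (f : section_ring k),
    [/\ (0 < n)%N, invariant_section n f & f.@[coefs F S] <> 0].

Lemma same_zeros_trans F S F' S' F'' S'' :
  same_zeros F S F' S' -> same_zeros F' S' F'' S'' -> same_zeros F S F'' S''.
Proof. by move=> E E' n f If; rewrite (E n f If) (E' n f If). Qed.

Lemma same_zeros_sym F S F' S' : same_zeros F S F' S' -> same_zeros F' S' F S.
Proof. by move=> E n f If; rewrite (E n f If). Qed.

Lemma same_zeros_semistable F S F' S' :
  same_zeros F S F' S' -> semistable_forms F S -> semistable_forms F' S'.
Proof. by move=> E [n [f [n0 If f0]]]; exists n, f; split=> //; rewrite -(E n f If). Qed.

Lemma same_zeros_git_quotient (x y : sspair k) :
  same_zeros (cubic x) (line x) (cubic y) (line y) -> git_quotient x = git_quotient y.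
Proof.
move=> E; apply: Proj_invariants_eq => /=.
by apply: funext => n; apply/seteqP; split=> f /= [If f0]; split=> //; apply/(E n f If).
Qed.

Lemma same_zeros_scale (a b : k) F S : a != 0 -> b != 0 ->
  same_zeros (a *: F) (b *: S) F S.
Proof.
move=> a0 b0 n f If; rewrite (coefs_scale _ _ _ _ If.1); split=> [/eqP|->].
  by rewrite !mulf_eq0 !expf_eq0 (negPf a0) (negPf b0) !andbF => /eqP.
by rewrite mulr0.
Qed.

Lemma same_zeros_subst h F S : h \in unitmx -> F \is 3.-homog -> S \is 1.-homog ->
  same_zeros F S (subst h F) (subst h S).
Proof. by move=> uh hF hS n f If; rewrite (invariant_subst If uh hF hS). Qed.

Lemma independent_unitmx (e : 'I_3 -> 'rV[k]_3) :
  (forall a b c, a *: e o0 + b *: e o1 + c *: e o2 = 0 -> [/\ a = 0, b = 0 & c = 0]) ->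
  \matrix_(i, j) e j 0 i \in unitmx.
Proof.
move=> ind; rewrite -unitmx_tr -row_free_unit -kermx_eq0.
apply/eqP/row_matrixP => i; rewrite row0.
set x := row i _; have : x *m (\matrix_(i, j) e j 0 i)^T = 0.
  by rewrite /x -row_mul mulmx_ker row0.
rewrite mulmx_sum_row sum3.
have E j : row j (\matrix_(i, j) e j 0 i)^T = e j.
  by apply/rowP => l; rewrite !mxE.
rewrite !E => /ind[x0 x1 x2]; apply/rowP; apply: ord3P; by rewrite ?x0 ?x1 ?x2 [RHS]mxE.
Qed.

(** The zeros of [S] form a plane, which does not fit in the span of [p] and so supplies [v];
    normalizing [w] turns [S] into a coordinate function of the frame. *)
Lemma line_frame S p : S \is 1.-homog -> S != 0 -> p != 0 -> S.@[p 0] = 0 ->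
  exists v w, [/\ S.@[v 0] = 0, S.@[w 0] = 1
    & forall a b c, a *: p + b *: v + c *: w = 0 -> [/\ a = 0, b = 0 & c = 0]].
Proof.
move=> hS S0 p0 Sp; pose s : 'cV[k]_3 := \col_i evalf S (std_basis k i).
have sE u : S.@[u 0] = (u *m s) 0 0.
  rewrite {1}(linear_formE hS) raddf_sum /= mxE; apply: eq_bigr => i _.
  by rewrite mevalZ mevalXU mulrC mxE.
have s0 : s != 0.
  apply: contraNneq S0 => s0; rewrite (linear_formE hS) big1 // => i _.
  by have /colP/(_ i) := s0; rewrite !mxE => ->; rewrite scale0r.
have [i si] : exists i, s i 0 != 0 by apply/cV0Pn.
have rK : \rank (kermx s) = 2%N.
  rewrite mxrank_ker; suff -> : \rank s = 1%N by [].
  apply/eqP; rewrite eqn_leq rank_leq_col lt0n mxrank_eq0.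
  exact: s0.
have /row_subPn[j Kj] : ~~ (kermx s <= p)%MS.
  by apply/negP => /mxrankS; rewrite rK => /leq_trans/(_ (rank_leq_row _)).
pose v := row j (kermx s); pose w : 'rV[k]_3 := (s i 0)^-1 *: delta_mx 0 i.
have Sv : (v *m s) 0 0 = 0 by rewrite -row_mul mulmx_ker row0 mxE.
have Sw : (w *m s) 0 0 = 1 by rewrite -scalemxAl mxE -rowE [row _ _ _ _]mxE mulVf.
exists v, w; split=> [||a b c abc]; rewrite ?sE //.
have c0 : c = 0.
  have D (x y : 'M[k]_1) : (x + y) 0 0 = x 0 0 + y 0 0 by rewrite mxE.
  have Z (x : k) (y : 'M[k]_1) : (x *: y) 0 0 = x * y 0 0 by rewrite mxE.
  have := congr1 (fun u => (u *m s) 0 0) abc.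
  rewrite !mulmxDl -(scalemxAl a) -(scalemxAl b) -(scalemxAl c) !D !Z
    Sv Sw -(sE p) Sp mul0mx mxE !mulr0 !add0r mulr1.
  by [].
move: abc; rewrite c0 scale0r addr0 => abc.
have b0 : b = 0.
  apply/eqP; apply: contraNT Kj => b0; apply/sub_rVP; exists (- (b^-1 * a)).
  move/eqP: abc; rewrite addrC addr_eq0 => /eqP/(congr1 ( *:%R b^-1)).
  by rewrite scalerA mulVf // scale1r scalerN scalerA scaleNr.
move/eqP: abc; rewrite b0 scale0r addr0 scaler_eq0 (negPf p0) orbF => /eqP a0.
by split.
Qed.

End Equivalence.

(** * Degeneration to the tacnodal pair *)

Section NormalForms.
Variable k : closedFieldType.
Implicit Types (F G S Q l : {mpoly k[3]}) (h : 'M[k]_3) (p u v w : 'rV[k]_3).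

Definition ord3_fun (T : Type) (a b c : T) (i : 'I_3) : T :=
  match val i with 0%N => a | 1%N => b | _ => c end.

(* The line x0 = 0 touches the conic at [0 : 0 : 1]; 'X_o2, with which this cubic
   is always paired, is the tangent line at [1 : 0 : 0]. *)
Definition tacnode : {mpoly k[3]} := 'X_o0 * ('X_o0 * 'X_o2 - 'X_o1 ^+ 2).

Lemma tacnodeE : tacnode = 'X_[mon 2 0 1] - 'X_[mon 1 2 0].
Proof. rewrite /tacnode !mon_mul; ring. Qed.

Lemma mon_homog (a b c : nat) : ('X_[mon a b c] : {mpoly k[3]}) \is (a + b + c).-homog.
Proof. by rewrite dhomogX /= mdeg_mon. Qed.

Lemma tacnode_homog : tacnode \is 3.-homog.
Proof. by rewrite tacnodeE; apply: rpredB; [apply: (mon_homog 2 0 1) | apply: (mon_homog 1 2 0)]. Qed.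

Lemma X_homog i : ('X_i : {mpoly k[3]}) \is 1.-homog.
Proof. by rewrite dhomogX /= mdeg1. Qed.

Lemma X_mon : [/\ U_(o0)%MM = mon 1 0 0, U_(o1)%MM = mon 0 1 0 & U_(o2)%MM = mon 0 0 1].
Proof. by split; rewrite [LHS]monE !mnm1E. Qed.

Lemma subst_diagX (d : 'rV[k]_3) i : subst (diag_mx d) 'X_i = d 0 i *: 'X_i.
Proof.
rewrite substX (bigD1 i) //= mxE eqxx big1 ?addr0 // => j ji.
by rewrite mxE eq_sym (negPf ji) scale0r.
Qed.

Definition limit_cubic (a b : k) : {mpoly k[3]} := a *: 'X_[mon 2 0 1] + b *: 'X_[mon 1 2 0].

Lemma limit_cubic_homog a b : limit_cubic a b \is 3.-homog.
Proof.
by apply: rpredD; apply: dhomogZ; [apply: (mon_homog 2 0 1) | apply: (mon_homog 1 2 0)].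
Qed.

Lemma limit_cubic_coef a b m : (limit_cubic a b)@_m =
  a * (m == mon 2 0 1)%:R + b * (m == mon 1 2 0)%:R.
Proof. by rewrite mcoeffD !mcoeffZ !mcoeffX ![mon _ _ _ == m]eq_sym. Qed.

Lemma X2_coef c m : (c *: 'X_o2 : {mpoly k[3]})@_m = c * (m == mon 0 0 1)%:R.
Proof. by case: X_mon => _ _ E; rewrite mcoeffZ mcoeffX E eq_sym. Qed.

Lemma limit_same_zeros a b c : a != 0 -> b != 0 -> c != 0 ->
  same_zeros (limit_cubic a b) (c *: 'X_o2) tacnode 'X_o2.
Proof.
(* Replacing x1 by r x1 turns -x1^2 into (b / a) x1^2. *)
move=> a0 b0 c0; have [r r2] := exists_root 1 (- b / a).
have r0 : r != 0.
  apply: contraNneq b0 => r0; move/eqP: r2.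
  by rewrite r0 expr0n /= mulNr eq_sym oppr_eq0 mulf_eq0 invr_eq0 (negPf a0) orbF.
pose d : 'rV[k]_3 := \row_i ord3_fun 1 r 1 i.
have FE : limit_cubic a b = a *: subst (diag_mx d) tacnode.
  rewrite tacnodeE !mon_mul rmorphB /= !substM !rmorphXn /= !subst_diagX !mxE.
  rewrite /limit_cubic !mon_mul /ord3_fun /= !scale1r !expr0 !expr1 !mulr1.
  rewrite -scalerAl -!scalerAr scalerA -[r * r]/(r ^+ 2) r2 scalerBr scalerA.
  by rewrite [a * (_ / _)]mulrCA mulfV // mulr1 scaleNr opprK.
have SE : c *: 'X_o2 = c *: subst (diag_mx d) 'X_o2.
  by rewrite subst_diagX mxE /ord3_fun /= scale1r.
rewrite FE SE; apply: (same_zeros_trans (same_zeros_scale _ _ a0 c0)).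
apply/same_zeros_sym/same_zeros_subst; [|exact: tacnode_homog | exact: X_homog].
by rewrite unitmxE det_diag prod3 !mxE /ord3_fun /= mul1r mulr1 unitfE.
Qed.

Lemma limit_semistable a b c : semistable_forms (limit_cubic a b) (c *: 'X_o2) ->
  [/\ a != 0, b != 0 & c != 0].
Proof.
move=> [n [f [n0 If f0]]].
(* Under these weights the cubic is its own limit and the line tends to 0, where every invariant of
   positive degree vanishes. *)
have unst F S (w : 'I_3 -> int) al : \sum_i w i = 0 -> F \is 3.-homog -> S \is 1.-homog ->
    (forall m, F@_m != 0 -> weight w m = al) ->
    (forall m, S@_m != 0 -> (- al < weight w m)%R) -> f.@[coefs F S] = 0.
  move=> w0 hF hS wF wS; rewrite (degenerate (al := al) (F0 := F) (S0 := 0) w0 If) //.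
  - by rewrite -[F]scale1r -(scale0r 0) (coefs_scale _ _ _ _ If.1) expr0n (gtn_eqF n0) mulr0 mul0r.
  - by move=> m /wF ->.
  - by move=> m /wS/ltW.
  - by move=> m; have [->|/wF->] := eqVneq F@_m 0; rewrite ?mul0rn // eqxx.
  move=> m; have [->|/wS] := eqVneq S@_m 0; first by rewrite mul0rn mcoeff0.
  by rewrite lt_def mcoeff0 => /andP[/negPf->].
have hX : c *: 'X_o2 \is 1.-homog by apply/dhomogZ/X_homog.
split; apply/eqP => z; apply: f0; rewrite z.
(* If a = 0, only x0 x1^2 is left; its weight is 1, and x2 has weight 0 > -1. *)
- apply: (unst _ _ (ord3_fun (-1) 1 0) 1) => //.
  + by rewrite sum3.
  + exact: limit_cubic_homog.
  + move=> m; rewrite limit_cubic_coef mul0r add0r.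
    by have [->|] := eqVneq m (mon 1 2 0); rewrite ?mulr0 ?eqxx // weight_mon.
  + move=> m; rewrite X2_coef.
    by have [->|] := eqVneq m (mon 0 0 1); rewrite ?mulr0 ?eqxx // weight_mon.
(* If b = 0, only x0^2 x2 is left; its weight is 3, and x2 has weight 1 > -3. *)
- apply: (unst _ _ (ord3_fun 1 (-2) 1) 3) => //.
  + by rewrite sum3.
  + exact: limit_cubic_homog.
  + move=> m; rewrite limit_cubic_coef mul0r addr0.
    by have [->|] := eqVneq m (mon 2 0 1); rewrite ?mulr0 ?eqxx // weight_mon.
  + move=> m; rewrite X2_coef.
    by have [->|] := eqVneq m (mon 0 0 1); rewrite ?mulr0 ?eqxx // weight_mon.
rewrite -[limit_cubic _ _]scale1r (coefs_scale _ _ _ _ If.1).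
by rewrite expr0n (gtn_eqF n0) mulr0 mul0r.
Qed.

(* The weights (1, 0, -1) and (-1, 0, 1), according to the sign [al], have the
   same limit because the two parts kept have opposite weights. *)
Lemma degenerate_to_tacnode (al : int) F S : al != 0 ->
    F \is 3.-homog -> S \is 1.-homog ->
    (forall a b c, F@_(mon a b c) != 0 -> (al <= al * (a%:Z - c%:Z))%R) ->
    (forall a b c, S@_(mon a b c) != 0 -> (- al <= al * (a%:Z - c%:Z))%R) ->
  semistable_forms F S -> same_zeros F S tacnode 'X_o2.
Proof.
move=> al0 hF hS wF wS ss.
pose w := ord3_fun al 0 (- al).
have wE a b c : weight w (mon a b c) = al * (a%:Z - c%:Z).
  by rewrite weight_mon /w /ord3_fun /= mul0r addr0 mulrBr mulNr.
pose F0 := limit_cubic F@_(mon 2 0 1) F@_(mon 1 2 0).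
pose S0 : {mpoly k[3]} := S@_(mon 0 0 1) *: 'X_o2.
have E : same_zeros F S F0 S0.
  move=> n f If; rewrite (degenerate (w := w) (al := al) (F0 := F0) (S0 := S0) _ If) //.
  - by rewrite sum3 /w /ord3_fun /= addr0 subrr.
  - by move=> m; rewrite (monE m) wE; apply: wF.
  - by move=> m; rewrite (monE m) wE; apply: wS.
  - move=> m; have [|m3] := eqVneq (mdeg m) 3%N; last first.
      rewrite (dhomog_nemf_coeff hF m3) mul0rn.
      exact: (dhomog_nemf_coeff (limit_cubic_homog _ _) m3).
    (* Cancelling [al] leaves a - c = 1, which in degree 3 singles out x0^2 x2 and x0 x1^2. *)
    move: m; apply: mon_ind => a b c abc; rewrite wE -[X in _ == X]mulr1 (inj_eq (mulfI al0)).
    rewrite limit_cubic_coef !mon_eq.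
    move: a b c abc => [|[|[|[|a]]]] [|[|[|[|b]]]] [|[|[|[|c]]]] //= _;
      by rewrite ?mulr1 ?mulr0 ?addr0 ?add0r.
  move=> m; have [|m1] := eqVneq (mdeg m) 1%N; last first.
    rewrite (dhomog_nemf_coeff hS m1) mul0rn.
    by apply: (dhomog_nemf_coeff _ m1); apply/dhomogZ/X_homog.
  move: m; apply: mon_ind => a b c abc; rewrite wE -[- al]mulrN1 (inj_eq (mulfI al0)).
  rewrite X2_coef mon_eq.
  by move: a b c abc => [|[|a]] [|[|b]] [|[|c]] //= _; rewrite ?mulr1 ?mulr0.
have [a0 b0 c0] := limit_semistable (same_zeros_semistable E ss).
exact/(same_zeros_trans E)/limit_same_zeros.
Qed.

Definition frame (u v w : 'rV[k]_3) : 'M[k]_3 := \matrix_(i, j) ord3_fun u v w j 0 i.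

Lemma frame_unitmx u v w :
  (forall a b c, a *: u + b *: v + c *: w = 0 -> [/\ a = 0, b = 0 & c = 0]) ->
  frame u v w \in unitmx.
Proof. by move=> ind; apply: independent_unitmx. Qed.

Lemma evalf_frame u v w G j :
  evalf G (fun i => frame u v w i j) = G.@[ord3_fun u v w j 0].
Proof. by apply: meval_eq => i; rewrite mxE. Qed.

Lemma grad_dot G p v : G \is 1.-homog -> \sum_i grad G p 0 i * v 0 i = G.@[v 0].
Proof.
move=> hG; rewrite [in RHS](linear_formE hG) raddf_sum /=; apply: eq_bigr => i _.
rewrite mevalZ mevalXU mxE; congr (_ * _).
have -> : G^`M(i) = (G@_U_(i))%:MP.
  apply/mpolyP => m; rewrite mcoeff_mderiv mcoeffC; have [->|m0] := eqVneq m 0%MM.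
    by rewrite add0m mnm0E mulr1.
  rewrite mulr0 (dhomog_nemf_coeff hG) ?mul0rn //= mdegD mdeg1 addn1 eqSS.
  by rewrite mdeg_eq0.
by rewrite mevalC (evalf_basis _ hG) mulm1n.
Qed.

(** In the frame with [p] at [1 : 0 : 0] and [S] equal to x2, the only cubic monomials with a - c >
    1 are x0^3 and x0^2 x1. Their coefficients are F(p) and the derivative of F at [p] along the
    line. The proportionality factor may be 0, so [p] may be singular. *)
Lemma tangent_same_zeros F S p : F \is 3.-homog -> S \is 1.-homog -> S != 0 ->
    p != 0 -> F.@[p 0] = 0 -> S.@[p 0] = 0 -> (exists c, grad F p = c *: grad S p) ->
  semistable_forms F S -> same_zeros F S tacnode 'X_o2.
Proof.
move=> hF hS S0 p0 Fp Sp [c gFS] ss.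
have [v [w [Sv Sw ind]]] := line_frame hS S0 p0 Sp.
pose h := frame p v w; have uh := frame_unitmx ind.
have E := same_zeros_subst uh hF hS; apply: (same_zeros_trans E).
have hF' := subst_homog h hF; have hS' := subst_homog h hS.
have SE : subst h S = 'X_o2.
  rewrite (subst_linear_form _ hS) sum3 !evalf_frame /ord3_fun /= Sp Sv Sw.
  by rewrite !scale0r !add0r scale1r.
have F300 : (subst h F)@_(mon 3 0 0) = 0.
  have <- : (U_(o0) *+ 3)%MM = mon 3 0 0 by rewrite [LHS]monE !mulmnE !mnm1E.
  by rewrite -(evalf_basis _ hF') subst_basis evalf_frame.
have F210 : (subst h F)@_(mon 2 1 0) = 0.
  have <- : (U_(o0) *+ 2 + U_(o1))%MM = mon 2 1 0.
    by rewrite [LHS]monE !mnmDE !mnm1E.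
  rewrite (subst_coef_grad _ hF) //; transitivity (\sum_i grad F p 0 i * v 0 i).
    apply: eq_bigr => i _; rewrite evalf_frame mulrC; congr (_ * _); first by rewrite mxE.
    by rewrite mxE.
  rewrite gFS; under eq_bigr => i _ do rewrite mxE -mulrA.
  by rewrite -mulr_sumr grad_dot // Sv mulr0.
apply: (degenerate_to_tacnode (al := -1)) => //; last exact: same_zeros_semistable ss.
- move=> x y z Fm; have xyz : (x + y + z)%N = 3%N.
    by rewrite -mdeg_mon; apply: (dhomog_mf hF'); rewrite mcoeff_msupp.
  move: x y z xyz Fm => [|[|[|[|x]]]] [|[|[|[|y]]]] [|[|[|[|z]]]] //= _.
    by rewrite F210 eqxx.
  by rewrite F300 eqxx.
move=> x y z; rewrite SE -['X_o2]scale1r X2_coef mon_eq.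
by case: x y z => [|x] [|y] [|[|z]] //=; rewrite mulr0 eqxx.
Qed.

End NormalForms.

Section MoreNormalForms.
Variable k : closedFieldType.
Implicit Types (F G S Q l : {mpoly k[3]}) (h : 'M[k]_3) (p u v w : 'rV[k]_3).

(** The frame is reversed: [p] goes to [0 : 0 : 1] and [l] to x0. Tangency removes x2^2 and x1 x2
    from Q, so a - c is at least 0 on Q and at least 1 on x0 Q, while any line satisfies a - c >=
    -1. *)
Lemma tacnode_same_zeros l Q S p : l \is 1.-homog -> l != 0 -> Q \is 2.-homog ->
    S \is 1.-homog -> p != 0 -> Q.@[p 0] = 0 -> l.@[p 0] = 0 ->
    (exists c, grad Q p = c *: grad l p) ->
  semistable_forms (l * Q) S -> same_zeros (l * Q) S (tacnode k) 'X_o2.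
Proof.
move=> hl l0 hQ hS p0 Qp lp [c gQl] ss.
have [v [w [lv lw ind]]] := line_frame hl l0 p0 lp.
have ind' x y z : x *: w + y *: v + z *: p = 0 -> [/\ x = 0, y = 0 & z = 0].
  by rewrite addrC [x *: w + _]addrC addrA => /ind[z0 y0 x0].
pose h := frame w v p; have uh := frame_unitmx ind'.
have hF : l * Q \is 3.-homog by apply: (@dhomogM _ _ _ 1 _ 2).
have E := same_zeros_subst uh hF hS; apply: (same_zeros_trans E).
have hF' := subst_homog h hF; have hQ' := subst_homog h hQ.
have lE : subst h l = 'X_o0.
  rewrite (subst_linear_form _ hl) sum3 !evalf_frame /ord3_fun /= lp lv lw.
  by rewrite !scale0r !addr0 scale1r.
have Q002 : (subst h Q)@_(mon 0 0 2) = 0.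
  have <- : (U_(o2) *+ 2)%MM = mon 0 0 2 by rewrite [LHS]monE !mulmnE !mnm1E.
  by rewrite -(evalf_basis _ hQ') subst_basis evalf_frame.
have Q011 : (subst h Q)@_(mon 0 1 1) = 0.
  have <- : (U_(o2) *+ 1 + U_(o1))%MM = mon 0 1 1 by rewrite [LHS]monE !mnmDE !mnm1E.
  rewrite (subst_coef_grad _ hQ) //; transitivity (\sum_i grad Q p 0 i * v 0 i).
    by apply: eq_bigr => i _; rewrite evalf_frame mulrC !mxE.
  rewrite gQl; under eq_bigr => i _ do rewrite mxE -mulrA.
  by rewrite -mulr_sumr grad_dot // lv mulr0.
have F_S a b d : (subst h (l * Q))@_(mon a.+1 b d) = (subst h Q)@_(mon a b d).
  rewrite substM lE mulrC; have -> : mon a.+1 b d = (U_(o0) + mon a b d)%MM.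
    by apply/mnmP; apply: ord3P; rewrite [RHS]mnmDE mnm1E ?(mon0, mon1, mon2).
  exact: mcoeffMX.
have F_0 b d : (subst h (l * Q))@_(mon 0 b d) = 0.
  apply: memN_msupp_eq0; rewrite substM lE mulrC (perm_mem (msuppMX _ _)).
  by apply/mapP => -[m _] /mnmP/(_ o0); rewrite mon0 mnmDE mnm1E eqxx.
apply: (degenerate_to_tacnode (al := 1)) => //.
- exact: subst_homog.
- move=> x y z Fm; have xyz : (x + y + z)%N = 3%N.
    by rewrite -mdeg_mon; apply: (dhomog_mf hF'); rewrite mcoeff_msupp.
  move: x y z xyz Fm => [|[|[|[|x]]]] [|[|[|[|y]]]] [|[|[|[|z]]]] //= _;
    by rewrite ?F_0 ?F_S ?Q002 ?Q011 ?eqxx.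
- move=> x y z Sm; have xyz : (x + y + z)%N = 1%N.
    by rewrite -mdeg_mon; apply: (dhomog_mf (subst_homog h hS)); rewrite mcoeff_msupp.
  by move: x y z xyz {Sm} => [|[|x]] [|[|y]] [|[|z]] //= _.
exact: same_zeros_semistable ss.
Qed.

Definition triangle : {mpoly k[3]} := 'X_o0 * 'X_o1 * 'X_o2.
Definition unit_line : {mpoly k[3]} := 'X_o0 + 'X_o1 + 'X_o2.

Lemma dhomogM3 l1 l2 l3 : l1 \is 1.-homog -> l2 \is 1.-homog -> l3 \is 1.-homog ->
  l1 * l2 * l3 \is 3.-homog.
Proof.
by move=> h1 h2 h3; apply: (@dhomogM _ _ _ 2 _ 1) => //; apply: (@dhomogM _ _ _ 1 _ 1).
Qed.

Lemma triangle_homog : triangle \is 3.-homog.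
Proof. by apply: dhomogM3; apply: X_homog. Qed.

Lemma unit_line_homog : unit_line \is 1.-homog.
Proof. by do !apply: rpredD; apply: X_homog. Qed.

Lemma mul_subst h g G : subst h (subst g G) = subst (g *m h) G.
Proof.
rewrite [G]mpolyE (linear_sum (subst g)) (linear_sum (subst h)) (linear_sum (subst (g *m h))) /=.
apply: eq_bigr => m _; rewrite !substZ.
congr (_ *: _); rewrite !subst_mnm (rmorph_prod (subst h)) /=; apply: eq_bigr => i _.
rewrite (rmorphXn (subst h)) /= (linear_sum (subst _)) /=; congr (_ ^+ _).
under eq_bigr => j _ do rewrite substZ substX scaler_sumr.
rewrite exchange_big; apply: eq_bigr => j _; rewrite mxE scaler_suml.
by apply: eq_bigr => l _; rewrite scalerA.
Qed.

Lemma grad_prod l1 l2 l3 p : l1.@[p 0] = 0 -> l2.@[p 0] = 0 -> grad (l1 * l2 * l3) p = 0.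
Proof.
by move=> p1 p2; apply/rowP => i; rewrite !mxE !mderivM !(mevalD, mevalM) p1 p2; ring.
Qed.

(** Once the sides are the coordinate axes, the coefficients of the line are its values at the
    vertices, and the torus, which only rescales the triangle, brings them to 1 when they are
    nonzero. *)
Lemma triangle_same_zeros l1 l2 l3 S :
    l1 \is 1.-homog -> l2 \is 1.-homog -> l3 \is 1.-homog -> S \is 1.-homog ->
    (forall p, l1.@[p 0] = 0 -> l2.@[p 0] = 0 -> l3.@[p 0] = 0 -> p = 0) ->
    transversal_line (l1 * l2 * l3) S ->
  same_zeros (l1 * l2 * l3) S triangle unit_line.
Proof.
move=> h1 h2 h3 hS ind tr.
pose L : 'M[k]_3 := \matrix_(i, j) evalf (ord3_fun l1 l2 l3 i) (std_basis k j).
have LX : [/\ l1 = subst L 'X_o0, l2 = subst L 'X_o1 & l3 = subst L 'X_o2].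
  by split; rewrite [LHS]linear_formE // substX; apply: eq_bigr => i _; rewrite mxE.
have LE p i : (ord3_fun l1 l2 l3 i).@[p 0] = (p *m L^T) 0 i.
  have hi : ord3_fun l1 l2 l3 i \is 1.-homog by move: i; apply: ord3P.
  rewrite [in LHS](linear_formE hi) raddf_sum /= mxE; apply: eq_bigr => j _.
  by rewrite mevalZ mevalXU !mxE mulrC.
have uL : L \in unitmx.
  rewrite -unitmx_tr -row_free_unit -kermx_eq0; apply/eqP/row_matrixP => i; rewrite row0.
  have K : row i (kermx L^T) *m L^T = 0 by rewrite -row_mul mulmx_ker row0.
  by apply: ind; [have := LE (row i (kermx L^T)) o0 | have := LE (row i (kermx L^T)) o1
    | have := LE (row i (kermx L^T)) o2]; rewrite K mxE.
pose M := invmx L; have uM : M \in unitmx by rewrite unitmx_inv.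
have lM : [/\ subst M l1 = 'X_o0, subst M l2 = 'X_o1 & subst M l3 = 'X_o2].
  have [-> -> ->] := LX.
  have I i : subst 1%:M 'X_i = 'X_i :> {mpoly k[3]}.
    by rewrite -[1%:M]/(scalar_mx 1) -diag_const_mx subst_diagX mxE scale1r.
  by split; rewrite mul_subst mulmxV.
pose c i := evalf S (fun j => M j i).
have hF : l1 * l2 * l3 \is 3.-homog by apply: dhomogM3.
have vertex (q : 'rV[k]_3) j : (forall a, (ord3_fun l1 l2 l3 a).@[q 0] = (a == j)%:R) ->
    (l1 * l2 * l3).@[q 0] = 0 /\ grad (l1 * l2 * l3) q = 0.
  move=> qj; move: (qj o0) (qj o1) (qj o2); rewrite /ord3_fun /= !mevalM.
  move: j {qj}; apply: ord3P => /= q1 q2 q3.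
  - by rewrite q2 mulr0 mul0r; split=> //; rewrite -mulrA mulrC; apply: grad_prod.
  - by rewrite q1 !mul0r; split=> //; rewrite mulrAC; apply: grad_prod.
  by rewrite q1 !mul0r; split=> //; apply: grad_prod.
(* At a vertex the gradient of the product is 0, so a line through it would violate the rank
   condition of transversality. *)
have c0 i : c i != 0.
  pose p : 'rV[k]_3 := \row_j M j i.
  have Sp : S.@[p 0] = c i by apply: meval_eq => j; rewrite mxE.
  have lp j : (ord3_fun l1 l2 l3 j).@[p 0] = (j == i)%:R.
    rewrite LE; have -> : p = row i M^T by apply/rowP => a; rewrite !mxE.
    by rewrite -row_mul -trmx_mul mulmxV // trmx1 !mxE eq_sym.
  have p0 : p != 0.
    apply/eqP => p0; have := lp i; rewrite LE p0 mul0mx mxE eqxx => /eqP.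
    by rewrite eq_sym oner_eq0.
  have Fp := vertex _ _ lp.
  apply/eqP => ci; have := tr p (conj p0 Fp.1) (conj p0 (etrans Sp ci)).
  rewrite Fp.2 => r2; have := rank_leq_row (grad S p).
  suff -> : \rank (grad S p) = 2%N by [].
  by rewrite -[RHS]r2 -addsmxE adds0mx.
have SM : subst M S = \sum_i c i *: 'X_i by exact: subst_linear_form.
have E := same_zeros_subst uM hF hS; apply: (same_zeros_trans E).
pose d : 'rV[k]_3 := \row_i (c i)^-1.
have ud : diag_mx d \in unitmx.
  by rewrite unitmxE det_diag unitfE prod3 !mxE !mulf_neq0 ?invr_eq0.
have E' := same_zeros_subst ud (subst_homog M hF) (subst_homog M hS).
apply: (same_zeros_trans E').
have -> : subst (diag_mx d) (subst M S) = 1 *: unit_line.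
  rewrite SM (linear_sum (subst _)) sum3 /= !substZ !subst_diagX !mxE !scalerA !mulfV //.
  by rewrite !scale1r.
have -> : subst (diag_mx d) (subst M (l1 * l2 * l3)) = (\prod_i d 0 i) *: triangle.
  have [E1 E2 E3] := lM.
  rewrite !substM E1 E2 E3 !subst_diagX prod3 /triangle -!scalerAl -!scalerAr !scalerA.
  by rewrite -!scalerAl !scalerA; congr (_ *: _); ring.
apply: same_zeros_scale; last exact: oner_neq0.
by rewrite prod3 !mxE !mulf_neq0 ?invr_eq0.
Qed.

End MoreNormalForms.

(** * Explicit pairs *)

Section Representatives.
Variable k : closedFieldType.
Implicit Types (F G S Q l A B : {mpoly k[3]}) (p u v w : 'rV[k]_3).

Lemma semistable_neq0 F S : semistable_forms F S -> F != 0 /\ S != 0.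
Proof.
move=> [n [f [n0 If f0]]]; split; apply/eqP => z; apply: f0; rewrite z.
  rewrite -(scale0r 0) -[S]scale1r (coefs_scale _ _ _ _ If.1).
  by rewrite expr0n (gtn_eqF n0) !mul0r.
rewrite -(scale0r 0) -[F]scale1r (coefs_scale _ _ _ _ If.1).
by rewrite expr0n (gtn_eqF n0) mulr0 mul0r.
Qed.

Lemma exists_sspair F S : F \is 3.-homog -> S \is 1.-homog -> semistable_forms F S ->
  exists x : sspair k, cubic x = F /\ line x = S.
Proof.
move=> hF hS ss; have [F0 S0] := semistable_neq0 ss.
by exists (@SSPair k (Pair hF F0 hS S0) ss).
Qed.

Lemma cayleyan_semistable F S : F \is 3.-homog -> S \is 1.-homog ->
  cayley_form F S != 0 -> semistable_forms F S.
Proof.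
move=> hF hS /eqP c0; exists 3%N, (cayleyan k); split=> //; first exact: cayleyan_invariant.
by rewrite cayleyan_meval.
Qed.

Lemma natr_prime_neq0 q : prime q -> q \notin [pchar k] -> q%:R != 0 :> k.
Proof. by move=> q_pr; rewrite !inE q_pr. Qed.

Lemma triangle_semistable : 2%:R != 0 :> k -> 3%:R != 0 :> k ->
  semistable_forms (triangle k) (unit_line k).
Proof.
move=> two_neq0 three_neq0; apply: cayleyan_semistable; [exact: triangle_homog | exact: unit_line_homog | ].
rewrite (@cayley_form_intr _ _ _ (fun x => x o0 * x o1 * x o2) (fun x => x o0 + x o1 + x o2)).
- rewrite cayley_int_triangle rmorphN /= oppr_eq0 -[24%Z]/((2 * 2 * 2 * 3)%N%:Z) -pmulrn.
  by rewrite !natrM !mulf_neq0.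
- by move=> x; rewrite /evalf !mevalM !mevalXU !rmorphM.
by move=> x; rewrite /evalf !mevalD !mevalXU !rmorphD.
Qed.

Lemma tacnode_semistable : 2%:R != 0 :> k -> 3%:R != 0 :> k ->
  semistable_forms (tacnode k) 'X_o2.
Proof.
move=> two_neq0 three_neq0; apply: cayleyan_semistable; [exact: tacnode_homog | exact: X_homog | ].
rewrite (@cayley_form_intr _ _ _ (fun x => x o0 * (x o0 * x o2 - x o1 * x o1)) (fun x => x o2)).
- rewrite cayley_int_tacnode -[48%Z]/((2 * 2 * 2 * 2 * 3)%N%:Z) -pmulrn.
  by rewrite !natrM !mulf_neq0.
- move=> x; rewrite /evalf /tacnode mevalM mevalB mevalM rmorphXn /= !mevalXU.
  by rewrite rmorphM rmorphB !rmorphM expr2.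
by move=> x; rewrite /evalf mevalXU.
Qed.

Lemma affine_form A : (msize A <= 2)%N -> A = (A@_0)%:MP + \sum_i A@_U_(i) *: 'X_i.
Proof.
move=> A2; apply/mpolyP => m; rewrite mcoeffD mcoeffC raddf_sum /=.
under eq_bigr => i _ do rewrite mcoeffZ mcoeffX.
have [->|m0] := eqVneq m 0%MM.
  by rewrite mulr1 big1 ?addr0 // => i _; rewrite mnm1_eq0 mulr0.
rewrite mulr0 add0r; have [|m1] := eqVneq (mdeg m) 1%N.
  move=> /mdeg_succ[i [m' [-> /eqP]]]; rewrite mdeg_eq0 => /eqP->; rewrite add0m.
  rewrite (bigD1 i) //= eqxx mulr1 big1 ?addr0 // => j ji.
  by rewrite eq_mnm1 (negPf ji) mulr0.
rewrite memN_msupp_eq0 ?big1 // => [i _|].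
  have [im|] := eqVneq U_(i)%MM m; last by rewrite mulr0.
  by rewrite -im mdeg1 in m1.
apply: msize_mdeg_ge; apply: leq_trans A2 _.
by rewrite ltn_neqAle eq_sym m1 lt0n mdeg_eq0.
Qed.

Lemma msize_unit A : A != 0 -> (msize A <= 1)%N -> A \is a GRing.unit.
Proof.
move=> A0 A1; have E := msize1_polyC A1; rewrite E; apply: rmorph_unit.
by rewrite unitfE; apply: contraNneq A0 => c0; rewrite E c0 mpolyC0.
Qed.

Lemma homog_nonunit d F : F \is d.+1.-homog -> F \isn't a GRing.unit.
Proof.
move=> hF; apply/negP => /(rmorph_unit (mcoeff 0%MM)) /=.
by rewrite (dhomog_nemf_coeff hF) ?unitr0 //= mdeg0.
Qed.

Lemma homog_msize_le d F : F \is d.-homog -> (msize F <= d.+1)%N.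
Proof.
move=> hF; rewrite msizeE big_seq; elim/big_rec: _ => // m x mF xd.
by rewrite geq_max xd andbT (dhomog_mf hF mF).
Qed.

(* A reducible form of degree at most 3 has an affine linear factor. *)
Lemma irreducible_no_plane d F : F \is d.+1.-homog -> (d < 3)%N -> F != 0 ->
  (forall (c : k) (a : 'I_3 -> k), (exists i, a i != 0) ->
    exists2 u : 'I_3 -> k, c + \sum_i a i * u i = 0 & F.@[u] != 0) ->
  irreducible_form F.
Proof.
move=> hF d3 F0 plane; split=> //; first exact: homog_nonunit hF.
(* [msize] is the degree plus one, so [A] is affine linear. Factors are not assumed homogeneous,
   hence the constant term in the plane. *)
have nofactor A B : F = A * B -> msize A = 2%N -> False.
  move=> E A2; have AE := affine_form (eq_leq A2).
  have /plane - /(_ A@_0) [u uA] : exists i, A@_U_(i) != 0.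
    apply/existsP; apply: contraPT A2; rewrite negb_exists => /forallP a0.
    rewrite AE big1 => [|i _]; last by move: (a0 i); rewrite negbK => /eqP->; rewrite scale0r.
    by rewrite addr0 msizeC; case: eqP.
  rewrite E mevalM {1}AE mevalD mevalC raddf_sum /=.
  under eq_bigr => i _ do rewrite mevalZ mevalXU.
  by rewrite uA mul0r eqxx.
move=> A B E; have := F0; rewrite E mulf_eq0 negb_or => /andP[A0 B0].
have [A1|A1] := leqP (msize A) 1; first by left; apply: msize_unit.
have [B1|B1] := leqP (msize B) 1; first by right; apply: msize_unit.
have := homog_msize_le hF; rewrite E msizeM // => sz.
have [A2|A2] := leqP (msize A) 2.
  by case: (nofactor A B E); apply/eqP; rewrite eqn_leq A2.
have [B2|B2] := leqP (msize B) 2.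
  by case: (nofactor B A); [rewrite mulrC | apply/eqP; rewrite eqn_leq B2].
(* Two factors of degree at least 2 would give degree at least 4. *)
by move: (mmeasure _ A) (mmeasure _ B) A2 B2 sz => a b; lia.
Qed.

Definition conic : {mpoly k[3]} := 'X_o0 * 'X_o2 - 'X_o1 ^+ 2.

Lemma conic_homog : conic \is 2.-homog.
Proof.
by apply: rpredB; rewrite ?expr2; apply: (@dhomogM _ _ _ 1 _ 1); apply: X_homog.
Qed.

Definition cusp_cubic : {mpoly k[3]} := 'X_o1 * 'X_o1 * 'X_o2 - 'X_o0 * 'X_o0 * 'X_o0.
(** The coefficients are the gradient of the cuspidal cubic at [1 : 1 : 1]. *)
Definition cusp_line : {mpoly k[3]} := - 3%:R *: 'X_o0 + 2%:R *: 'X_o1 + 'X_o2.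

Lemma cusp_cubic_homog : cusp_cubic \is 3.-homog.
Proof. by apply: rpredB; apply: dhomogM3; apply: X_homog. Qed.

Lemma cusp_line_homog : cusp_line \is 1.-homog.
Proof. by do !apply: rpredD; rewrite ?dhomogZ ?X_homog. Qed.

Lemma cusp_cubic_semistable : 2%:R != 0 :> k -> 3%:R != 0 :> k ->
  semistable_forms cusp_cubic cusp_line.
Proof.
move=> two_neq0 three_neq0; apply: cayleyan_semistable;
  [exact: cusp_cubic_homog | exact: cusp_line_homog | ].
rewrite (@cayley_form_intr _ _ _ (fun x => x o1 * x o1 * x o2 - x o0 * x o0 * x o0)
  (fun x => - 3%:Z * x o0 + 2%:Z * x o1 + x o2)).
- rewrite cayley_int_cusp -[432%:Z]/((2 * 2 * 2 * 2 * (3 * 3 * 3))%N%:Z) -pmulrn.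
  by rewrite !natrM !mulf_neq0.
- by move=> x; rewrite /evalf mevalB !mevalM !mevalXU rmorphB !rmorphM.
by move=> x; rewrite /evalf !mevalD !mevalZ !mevalXU !rmorphD !rmorphM rmorphN.
Qed.

Lemma conic_irreducible : irreducible_conic conic.
Proof.
split; first exact: conic_homog.
have ev (u : 'I_3 -> k) : conic.@[u] = u o0 * u o2 - u o1 * u o1.
  by rewrite /conic expr2 mevalB !mevalM !mevalXU.
apply: (irreducible_no_plane conic_homog) => //.
  apply/eqP => z; have := ev (fun i => (i != o1)%:R); rewrite z meval0 /= mulr1 mulr0 subr0.
  by move/eqP; rewrite eq_sym oner_eq0.
move=> c a [i ai];
have [a2|a2] := eqVneq (a o2) 0; last first.
  exists (ord3_fun 0 1 (- (c + a o1) / a o2)); rewrite ?sum3 ?ev /ord3_fun /=.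
    by field.
  by rewrite mul0r mulr1 sub0r oppr_eq0 oner_eq0.
have [a1|a1] := eqVneq (a o1) 0; last first.
  (* The last coordinate is free since [a o2] is 0; the choice y^2 + 1 gives the conic the value
     1. *)
  pose y := - (c + a o0) / a o1.
  exists (ord3_fun 1 y (y * y + 1)); rewrite ?sum3 ?ev /ord3_fun /=.
    by rewrite /y a2; field.
  by rewrite mul1r addrC addrA addNr add0r oner_eq0.
have a0 : a o0 != 0 by move: i ai; apply: ord3P => //; rewrite ?a1 ?a2 ?eqxx.
exists (ord3_fun (- c / a o0) 1 0); rewrite ?sum3 ?ev /ord3_fun /=.
  by rewrite a1; field.
by rewrite mulr0 mulr1 sub0r oppr_eq0 oner_eq0.
Qed.

Lemma cusp_cubic_irreducible : irreducible_form cusp_cubic.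
Proof.
have ev (u : 'I_3 -> k) : cusp_cubic.@[u] = u o1 * u o1 * u o2 - u o0 * u o0 * u o0.
  by rewrite /cusp_cubic mevalB !mevalM !mevalXU.
apply: (irreducible_no_plane cusp_cubic_homog) => //.
  apply/eqP => z; have := ev (fun i => (i != o0)%:R); rewrite z meval0 /= !mulr1 mulr0 subr0.
  by move/eqP; rewrite eq_sym oner_eq0.
move=> c a [i ai].
have [a2|a2] := eqVneq (a o2) 0; last first.
  exists (ord3_fun 1 0 (- (c + a o0) / a o2)); rewrite ?sum3 ?ev /ord3_fun /=.
    by field.
  by rewrite !mul0r !mulr1 sub0r oppr_eq0 oner_eq0.
have [a1|a1] := eqVneq (a o1) 0; last first.
  exists (ord3_fun 1 (- (c + a o0) / a o1) 0); rewrite ?sum3 ?ev /ord3_fun /=.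
    by field.
  by rewrite !mulr0 !mulr1 sub0r oppr_eq0 oner_eq0.
have a0 : a o0 != 0 by move: i ai; apply: ord3P => //; rewrite ?a1 ?a2 ?eqxx.
pose x := - c / a o0.
exists (ord3_fun x 1 (x * x * x + 1)); rewrite ?sum3 ?ev /ord3_fun /=.
  by rewrite /x a1 a2; field.
by rewrite !mul1r addrC addrA addNr add0r oner_eq0.
Qed.

End Representatives.

(** * Tangency, transversality and the cusp on explicit pairs *)

Section Tangency.
Variable k : closedFieldType.
Implicit Types (F G S Q l : {mpoly k[3]}) (p u v w : 'rV[k]_3).

Let point (a b c : k) : 'rV[k]_3 := \row_i ord3_fun a b c i.

Lemma point_neq0 a b c i : ord3_fun a b c i != 0 -> point a b c != 0.
Proof. by apply: contraNneq => /rowP/(_ i); rewrite !mxE => ->. Qed.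

Lemma grad_X i p j : grad ('X_i : {mpoly k[3]}) p 0 j = (i == j)%:R.
Proof. by rewrite mxE mderivXU raddfMn /= meval1. Qed.

Lemma grad_conic p : grad (conic k) p = point (p 0 o2) (- (p 0 o1 *+ 2)) (p 0 o0).
Proof.
apply/rowP; apply: ord3P; rewrite !mxE /conic expr2 mderivB !mderivM !mderivXU;
by rewrite !(mevalB, mevalD, mevalM) ?mevalXU ?meval1 ?meval0 /ord3_fun /=; ring.
Qed.

Lemma conic_eval u : (conic k).@[u 0] = u 0 o0 * u 0 o2 - u 0 o1 ^+ 2.
Proof. by rewrite mevalB mevalM rmorphXn /= !mevalXU. Qed.

Lemma conic_tangent2 : tangent (conic k) 'X_o2.
Proof.
have p0 : point 1 0 0 != 0 by apply: (@point_neq0 _ _ _ o0); rewrite /ord3_fun oner_eq0.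
exists (point 1 0 0); split.
- by split=> //; rewrite conic_eval !mxE /ord3_fun /= expr0n mulr0 subr0.
- by split=> //; rewrite mevalXU mxE.
- by rewrite grad_conic !mxE /ord3_fun /=; apply: (@point_neq0 _ _ _ o2); rewrite /ord3_fun /= oner_eq0.
exists 1; rewrite scale1r grad_conic !mxE; apply/rowP; apply: ord3P;
by rewrite grad_X mxE /ord3_fun /= ?mul0rn ?oppr0.
Qed.

Lemma conic_tangent0 : tangent (conic k) 'X_o0.
Proof.
have p0 : point 0 0 1 != 0 by apply: (@point_neq0 _ _ _ o2); rewrite /ord3_fun /= oner_eq0.
exists (point 0 0 1); split.
- by split=> //; rewrite conic_eval !mxE /ord3_fun /= expr0n mul0r subr0.
- by split=> //; rewrite mevalXU mxE.
- by rewrite grad_conic !mxE /ord3_fun /=; apply: (@point_neq0 _ _ _ o0); rewrite /ord3_fun /= oner_eq0.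
exists 1; rewrite scale1r grad_conic !mxE; apply/rowP; apply: ord3P;
by rewrite grad_X mxE /ord3_fun /= ?mul0rn ?oppr0.
Qed.

Lemma rank2P u v : (forall x y, x *: u + y *: v = 0 -> x = 0 /\ y = 0) ->
  \rank (col_mx u v) = 2%N.
Proof.
move=> ind; apply/eqP; rewrite -[_ == _]/(row_free _) -kermx_eq0.
apply/eqP/row_matrixP => i; rewrite row0; set x := row i _.
have : x *m col_mx u v = 0 by rewrite /x -row_mul mulmx_ker row0.
rewrite -[x](@hsubmxK _ 1 1 1) mul_row_col [lsubmx _]mx11_scalar [rsubmx _]mx11_scalar.
by rewrite !mul_scalar_mx => /ind[-> ->]; rewrite !raddf0 row_mx0.
Qed.

Lemma triangle_transversal : transversal_line (triangle k) (unit_line k).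
Proof.
move=> p [p0 Tp] [_ Lp]; apply: rank2P => x y.
have Tp' : p 0 o0 * p 0 o1 * p 0 o2 = 0 by move: Tp; rewrite !mevalM !mevalXU.
have Lp' : p 0 o0 + p 0 o1 + p 0 o2 = 0 by move: Lp; rewrite !mevalD !mevalXU.
have gT : grad (triangle k) p =
    point (p 0 o1 * p 0 o2) (p 0 o0 * p 0 o2) (p 0 o0 * p 0 o1).
  apply/rowP; apply: ord3P; rewrite !mxE !mderivM !mderivXU;
  by rewrite !(mevalD, mevalM) ?mevalXU ?meval1 ?meval0 /ord3_fun /=; ring.
have gL : grad (unit_line k) p = point 1 1 1.
  apply/rowP; apply: ord3P; rewrite !mxE !mderivD !mderivXU;
  by rewrite !mevalD ?meval1 ?meval0 /ord3_fun /=; ring.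
rewrite gT gL => /rowP E; move: (E o0) (E o1) (E o2) => {E}.
rewrite !mxE /ord3_fun /= !mulr1.
have nz : [|| p 0 o0 != 0, p 0 o1 != 0 | p 0 o2 != 0].
  apply: contraNT p0; rewrite !negb_or !negbK => /and3P[/eqP e0 /eqP e1 /eqP e2].
  by apply/eqP/rowP; apply: ord3P; rewrite mxE.
(* On one side of the triangle the other two coordinates are opposite and nonzero; their product is
   the only nonzero entry of the gradient. *)
have aux (a b z : k) : a + b = 0 -> (a != 0) || (b != 0) -> z * (a * b) = 0 -> z = 0.
  move=> /eqP; rewrite addr_eq0 => /eqP -> ; rewrite oppr_eq0 orbb => b0 /eqP.
  by rewrite !mulf_eq0 oppr_eq0 !(negPf b0) !orbF => /eqP.
move/eqP: Tp'; rewrite !mulf_eq0 => /orP[/orP[]|] /eqP z;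
  move: Lp' nz; rewrite z ?mul0r ?mulr0 ?add0r ?addr0 eqxx ?orbF /= => L n.
- by move=> E y0 _; split=> //; move: E; rewrite y0 addr0; apply: aux.
- by move=> y0 E _; split=> //; move: E; rewrite y0 addr0; apply: aux.
by move=> y0 _ E; split=> //; move: E; rewrite y0 addr0; apply: aux.
Qed.

Lemma grad_cusp_cubic p : grad (cusp_cubic k) p =
  point (- (p 0 o0 ^+ 2 *+ 3)) (p 0 o1 * p 0 o2 *+ 2) (p 0 o1 ^+ 2).
Proof.
apply/rowP; apply: ord3P; rewrite !mxE /cusp_cubic mderivB !mderivM !mderivXU;
by rewrite !(mevalB, mevalD, mevalM) ?mevalXU ?meval1 ?meval0 /ord3_fun /=; ring.
Qed.

Lemma cusp_cubic_eval u :
  (cusp_cubic k).@[u 0] = u 0 o1 * u 0 o1 * u 0 o2 - u 0 o0 * u 0 o0 * u 0 o0.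
Proof. by rewrite mevalB !mevalM !mevalXU. Qed.

Lemma cusp_line_eval u : (cusp_line k).@[u 0] = - 3%:R * u 0 o0 + 2%:R * u 0 o1 + u 0 o2.
Proof. by rewrite !mevalD !mevalZ !mevalXU. Qed.

Lemma grad_cusp_line p : grad (cusp_line k) p = point (- 3%:R) 2%:R 1.
Proof.
apply/rowP; apply: ord3P; rewrite !mxE !mderivD !mderivZ !mderivXU;
by rewrite !mevalD !mevalZ ?meval1 ?meval0 /ord3_fun /=; ring.
Qed.

Lemma along_cusp_cubic p q : along (cusp_cubic k) p q =
  ((p 0 o1)%:P + q 0 o1 *: 'X) * ((p 0 o1)%:P + q 0 o1 *: 'X) * ((p 0 o2)%:P + q 0 o2 *: 'X)
  - ((p 0 o0)%:P + q 0 o0 *: 'X) * ((p 0 o0)%:P + q 0 o0 *: 'X) * ((p 0 o0)%:P + q 0 o0 *: 'X).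
Proof.
have X i : mmap (@polyC k) (fun i => (p 0 i)%:P + q 0 i *: 'X) 'X_i = (p 0 i)%:P + q 0 i *: 'X.
  by rewrite mmapX mmap1U.
by rewrite /along mmapB !rmorphM /= !X.
Qed.

Lemma cusp_cubic_cusp : cusp_at (cusp_cubic k) (point 0 0 1).
Proof.
have p0 : point 0 0 1 != 0 by apply: (@point_neq0 _ _ _ o2); rewrite /ord3_fun /= oner_eq0.
have A v : along (cusp_cubic k) (point 0 0 1) v =
    (v 0 o1 ^+ 2) *: 'X^2 + (v 0 o1 ^+ 2 * v 0 o2 - v 0 o0 ^+ 3) *: 'X^3.
  rewrite along_cusp_cubic !mxE /ord3_fun /= -!mul_polyC polyCB [(_ * v 0 o2)%:P]polyCM !polyC_exp.
  by rewrite polyC0 polyC1; ring.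
split.
- by split=> //; rewrite cusp_cubic_eval !mxE /ord3_fun /= !mulr0 mul0r subr0.
- apply/rowP; apply: ord3P; rewrite grad_cusp_cubic !mxE /ord3_fun /=;
  by rewrite ?mul0r ?expr0n ?mul0rn ?oppr0.
exists 'X_o1; split.
- split; first exact: X_homog.
  by apply/eqP => z; have := meval1 (fun=> 1 : k); have := mevalXU (fun=> 1 : k) o1;
    rewrite z meval0 => /eqP; rewrite eq_sym oner_eq0.
- by move=> v; rewrite A coefD !coefZ !coefXn /= mulr1 mulr0 addr0 mevalXU.
move=> v; rewrite mevalXU => v1 r2.
rewrite A coefD !coefZ !coefXn /= v1 expr0n /= !mul0r !mulr1 !add0r => /eqP.
rewrite oppr_eq0 expf_eq0 /= => /eqP v0.
(* On the tangent cone the cubic coefficient is -v0^3, so its vanishing would make [v] a multiple of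
   the cusp. *)
suff /mxrankS : (col_mx (point 0 0 1) v <= point 0 0 1)%MS.
  by rewrite r2 => /leq_trans/(_ (rank_leq_row _)).
rewrite col_mx_sub submx_refl; apply/sub_rVP; exists (v 0 o2).
by apply/rowP; apply: ord3P; rewrite !mxE /ord3_fun /= ?mulr0 ?mulr1.
Qed.

Lemma cusp_cubic_two_tangent : 3%:R != 0 :> k -> two_tangent (cusp_cubic k) (cusp_line k).
Proof.
move=> three_neq0.
have p0 : point 1 1 1 != 0 by apply: (@point_neq0 _ _ _ o2); rewrite /ord3_fun /= oner_eq0.
have gE : grad (cusp_cubic k) (point 1 1 1) = grad (cusp_line k) (point 1 1 1).
  rewrite grad_cusp_cubic grad_cusp_line !mxE /ord3_fun /=.
  by congr (point _ _ _); rewrite ?expr1n ?mulr1.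
exists (point 1 1 1); split; first split.
- by split=> //; rewrite cusp_cubic_eval !mxE /ord3_fun /= !mulr1 subrr.
- by split=> //; rewrite cusp_line_eval !mxE /ord3_fun /=; ring.
- rewrite gE grad_cusp_line; apply: (@point_neq0 _ _ _ o2); by rewrite /ord3_fun /= oner_eq0.
- by exists 1; rewrite scale1r.
(* The direction (1, 0, 3) lies on the line, and the cubic restricts to -3 t^2 - t^3 along it. *)
move=> /(_ (point 1 0 3%:R)); rewrite cusp_line_eval !mxE /ord3_fun /=.
have -> : - 3%:R * 1 + 2%:R * 0 + 3%:R = 0 :> k by ring.
move=> /(_ erefl)/dvdpP[f]; rewrite along_cusp_cubic !mxE /ord3_fun /= => E.
have : (- 3%:R *: 'X^2 - 'X^3 : {poly k}) = f * 'X^3.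
  rewrite -E -!mul_polyC polyCN !(polyC0, polyC1, polyC_natr).
  ring.
move=> /(congr1 (fun f : {poly k} => f`_2)).
rewrite /= coefMXn /= coefB coefZ !coefXn /= mulr1 subr0 => /eqP.
by rewrite oppr_eq0 (negPf three_neq0).
Qed.

(** At a zero of Q the gradient of l Q is l(p) times that of Q, hence still proportional to the
    gradient of S, even if [p] lies on [l]. *)
Lemma tangent_component l Q S : l \is 1.-homog -> Q \is 2.-homog -> S \is 1.-homog ->
  S != 0 -> tangent Q S -> semistable_forms (l * Q) S ->
  same_zeros (l * Q) S (tacnode k) 'X_o2.
Proof.
move=> hl hQ hS S0 [p [[p0 Qp] [_ Sp] _ [c gQ]]].
apply: tangent_same_zeros p0 _ Sp _ => //; first exact: (@dhomogM _ _ _ 1 _ 2).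
  by rewrite mevalM Qp mulr0.
exists (l.@[p 0] * c); rewrite -scalerA -gQ; apply/rowP => i.
by rewrite !mxE mderivM mevalD !mevalM Qp mulr0 add0r.
Qed.

End Tangency.

(** * Images of the loci *)

Lemma image_set1 (T U : Type) (f : T -> U) (A : set T) (x0 : T) (y : U) :
  A x0 -> (forall x, A x -> f x = y) -> f @` A = [set y].
Proof.
move=> Ax0 fA; apply/seteqP; split=> [_ [x Ax <-]|_ ->]; first exact: fA.
by exists x0 => //; apply: fA.
Qed.

Theorem proposition2p10 (k : closedFieldType)
    (char_neq2 : 2%N \notin [pchar k]) (char_neq3 : 3%N \notin [pchar k]) :
  [/\ exists P, git_quotient @` S3 k = [set P],
      exists P, git_quotient @` S5 k = [set P],
      exists P, git_quotient @` S6 k = [set P],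
      exists P, git_quotient @` S7 k = [set P]
    & exists P, git_quotient @` S11 k = [set P]] /\
  [/\ git_quotient @` S5 k = git_quotient @` S6 k,
      git_quotient @` S6 k = git_quotient @` S7 k
    & git_quotient @` S7 k = git_quotient @` S11 k].
Proof.
have two0 := natr_prime_neq0 (erefl : prime 2) char_neq2.
have three0 := natr_prime_neq0 (erefl : prime 3) char_neq3.
have lX i : linear_form ('X_i : {mpoly k[3]}).
  by split; [exact: X_homog | rewrite -msupp_eq0 msuppX].
have [t [tF tS]] := exists_sspair (triangle_homog k) (unit_line_homog k)
  (triangle_semistable two0 three0).
have [y [yF yS]] := exists_sspair (tacnode_homog k) (X_homog k o2)
  (tacnode_semistable two0 three0).
have [z [zF zS]] := exists_sspair (cusp_cubic_homog k) (cusp_line_homog k)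
  (cusp_cubic_semistable two0 three0).
have S3E : git_quotient @` S3 k = [set git_quotient t].
  apply: (image_set1 (x0 := t)) => [|x [[l1 [l2 [l3 [[h1 _] [h2 _] [h3 _] ind xF]]]] tr]].
    split; last by rewrite tF tS; apply: triangle_transversal.
    exists 'X_o0, 'X_o1, 'X_o2; split=> // p; rewrite !mevalXU => p0 p1 p2.
    by apply/rowP; apply: ord3P; rewrite mxE.
  apply: same_zeros_git_quotient; rewrite tF tS xF.
  by apply: triangle_same_zeros; rewrite -?xF //; exact: line_homog.
(* The tacnodal pair is a common member of S5, S6 and S7. *)
have y7 : S7 k y.
  exists 'X_o0, (conic k); rewrite yF yS; split=> //; first exact: conic_irreducible.
    exact: conic_tangent2.
  exact: conic_tangent0.
have to_y (x : sspair k) :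
    same_zeros (cubic x) (line x) (tacnode k) 'X_o2 -> git_quotient x = git_quotient y.
  by move=> E; apply: same_zeros_git_quotient; rewrite yF yS.
have S5y x : S5 k x -> git_quotient x = git_quotient y.
  move=> [l [Q [[hl _] [hQ _] xF tQ]]]; apply: to_y; have := sspairP x; rewrite /semistable xF.
  by apply: tangent_component => //; [exact: line_homog | exact: line_neq0].
have S5E : git_quotient @` S5 k = [set git_quotient y].
  apply: (image_set1 (x0 := y)) => //.
  by case: y7 => l [Q [hl hQ yE tS' _]]; exists l, Q; split.
have S6E : git_quotient @` S6 k = [set git_quotient y].
  apply: (image_set1 (x0 := y)).
    by case: y7 => l [Q [hl hQ yE _ tl]]; exists l, Q; split.
  move=> x [l [Q [[hl l0] [hQ _] xF [p [[p0 Qp] [_ lp] _ gQ]]]]]; apply: to_y.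
  have := sspairP x; rewrite /semistable xF => ss.
  by apply: tacnode_same_zeros p0 Qp lp gQ ss => //; exact: line_homog.
have S7E : git_quotient @` S7 k = [set git_quotient y].
  apply: (image_set1 (x0 := y)) => // x [l [Q [hl hQ xF tQ _]]].
  by apply: S5y; exists l, Q; split.
have S11E : git_quotient @` S11 k = [set git_quotient y].
  (* The tacnodal cubic is reducible, so the member of S11 has to be the cuspidal pair. *)
  apply: (image_set1 (x0 := z)).
    split; rewrite zF ?zS; first exact: cusp_cubic_irreducible.
      by eexists; exact: cusp_cubic_cusp.
    exact: cusp_cubic_two_tangent.
  move=> x [_ _ [p [[[p0 Fp] [_ Sp] _ gF] _]]]; apply: to_y.
  apply: tangent_same_zeros p0 Fp Sp gF (sspairP x);
    [exact: cubic_homog | exact: line_homog | exact: line_neq0].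
by rewrite S3E S5E S6E S7E S11E; split; split=> //; eexists.
Qed.
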